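(* Let $m\in\mathbb{N}$ and $p\in\mathbb{N}_0$, and let $\{V_{p,j}\}_{j\in\mathbb{Z}}$ be the sequence of closed subspaces of $L_2(\mathbb{R})$ generated by the B-spline quarks $\varphi_0,\dots,\varphi_p$ of order $m$, i.e. $V_{p,j}=\overline{\mathrm{span}\{2^{j/2}\varphi_q(2^j\cdot-k):0\le q\le p,\ k\in\mathbb{Z}\}}$. Then the sequence $\{V_{p,j}\}_{j\in\mathbb{Z}}$ fulfills the properties (i)--(v) of a multiresolution analysis: (i) $V_{p,j}\subset V_{p,j+1}$ for all $j\in\mathbb{Z}$; (ii) $\overline{\bigcup_{j\in\mathbb{Z}}V_{p,j}}=L_2(\mathbb{R})$; (iii) $\bigcap_{j\in\mathbb{Z}}V_{p,j}=\{0\}$; (iv) $f\in V_{p,j}$ if and only if $f(\cdot-2^{-j}k)\in V_{p,j}$, for all $j,k\in\mathbb{Z}$; (v) $f\in V_{p,j}$ if and only if $f(2\,\cdot)\in V_{p,j+1}$, for all $j\in\mathbb{Z}$. Let in addition either $m=1$ or $p=0$. Then $\{V_{p,j}\}_{j\in\mathbb{Z}}$ is a multiresolution analysis with a multiscaling function of multiplicity $p+1$.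
   Context: $\mathbb{N}=\{1,2,\dots\}$, $\mathbb{N}_0=\mathbb{N}\cup\{0\}$. Cardinal B-splines: $N_1=\chi_{[0,1)}$ and $N_m(x)=\int_0^1N_{m-1}(x-t)\,dt$ for $m>1$. For fixed $m\in\mathbb{N}$ and $p\in\mathbb{N}_0$ the $p$-th cardinal B-spline quark is $\varphi_p(x)=\big(x/\lceil m/2\rceil\big)^pN_m(x+\lfloor m/2\rfloor)$. Span means the set of all finite linear combinations (complex coefficients), and $\overline{G}$ is the closure of $G$ in $L_2(\mathbb{R})$. A function vector $F=(f_1,\dots,f_n)^T\in(L_2(\mathbb{R}))^n$ is $L_2$-stable if there are constants $0<C_1\le C_2<\infty$ with $C_1\sum_{k}\overline{v}_k^Tv_k\le\|\sum_k\overline{v}_k^TF(\cdot-k)\,|\,L_2(\mathbb{R})\|^2\le C_2\sum_k\overline{v}_k^Tv_k$ for all vector sequences $\{v_k\}_{k\in\mathbb{Z}}$, $v_k\in\mathbb{C}^n$, with $\sum_k\overline{v}_k^Tv_k<\infty$. A sequence $\{V_j\}_{j\in\mathbb{Z}}$ of closed subspaces of $L_2(\mathbb{R})$ is a multiresolution analysis if (i)--(v) listed in the claim hold (with $V_j$ in place of $V_{p,j}$), and (vi) for some $r\in\mathbb{N}$ there exists an $L_2$-stable function vector $G=(g_1,\dots,g_r)^T$ of $r$ functions in $L_2(\mathbb{R})$ such that $V_0=\overline{\mathrm{span}\{g_l(\cdot-k):l\in\{1,\dots,r\},k\in\mathbb{Z}\}}$. Such a $G$ is called a multiscaling function of multiplicity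 $r$. *)

(* Defs.v *)
From HB Require Import structures.
From mathcomp Require Import all_boot all_order all_algebra.
From mathcomp Require Import finmap complex.
From mathcomp Require Import all_classical all_reals all_analysis.
From mathcomp.analysis.showcase Require Import summability.

Set Implicit Arguments.
Unset Strict Implicit.
Unset Printing Implicit Defensive.

Import Order.TTheory GRing.Theory Num.Theory.
Import numFieldNormedType.Exports.

Local Open Scope classical_set_scope.
Local Open Scope ring_scope.
Local Open Scope complex_scope.

(* Elements of L_2(R) are represented by functions f : R -> R[i], not by classes
   modulo equality almost everywhere.  Every subspace considered below is equal
   to its closure for the L_2 seminorm, hence is saturated for almost everywhere
   equality, so that equalities and inclusions between such sets of functions
   are the usual ones.  Measurability is with respect to the Borel sets; each
   class modulo equality almost everywhere has a Borel representative. *)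
Section L2.
Context {R : realType}.
Implicit Types (f g h : R -> R[i]) (S : set (R -> R[i])).

Definition L2norm f : \bar R :=
  Lnorm (@lebesgue_measure R) 2%:E (fun x => (ComplexField.Normc.normc (f x))%:E).

Definition L2 : set (R -> R[i]) :=
  [set f | [/\ measurable_fun setT (fun x => complex.Re (f x)),
               measurable_fun setT (fun x => complex.Im (f x)) &
               (L2norm f < +oo)%E]].

Definition L2closure S : set (R -> R[i]) :=
  [set f | L2 f /\
     forall e : R, 0 < e ->
       exists2 g, S g & (L2norm (fun x => (f x - g x)%R) < e%:E)%E].

Definition linear_span S : set (R -> R[i]) :=
  [set h | exists (n : nat) (c : 'I_n -> R[i]) (g : 'I_n -> R -> R[i]),
     (forall i, S (g i)) /\ h = (fun x => \sum_(i < n) c i * g i x)].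

Definition closed_subspace S : Prop :=
  [/\ S `<=` L2, S (fun=> 0),
      forall (a : R[i]) f g, S f -> S g -> S (fun x => a * f x + g x) &
      L2closure S = S].

End L2.

Section StableVectors.
Context {R : realType} {n : nat}.
Implicit Types (F : 'I_n -> R -> R[i]) (v : int -> 'cV[R[i]]_n).

Definition l2_energy v : \bar R :=
  (\esum_(k in [set: int])
     (\sum_(l < n) ComplexField.Normc.normc (v k l ord0) ^+ 2)%R%:E)%E.

Definition shift_sum F v (A : {fset int}) : R -> R[i] :=
  fun x => \sum_(k <- A) \sum_(l < n) (v k l ord0)^* * F l (x - k%:~R).

(* The bi-infinite series is read as the unconditional limit in L_2 of its
   finite partial sums; h is determined up to equality almost everywhere. *)
Definition shift_series F v (h : R -> R[i]) : Prop :=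
  L2 h /\
  L2norm (fun x => h x - shift_sum F v A x) @[A --> totally] --> (0 : \bar R).

Definition L2_stable F : Prop :=
  (forall l, L2 (F l)) /\
  exists C1 C2 : R, 0 < C1 <= C2 /\
    forall v, (l2_energy v < +oo)%E ->
      exists h, [/\ shift_series F v h,
        (C1%:E * l2_energy v <= L2norm h ^+ 2)%E &
        (L2norm h ^+ 2 <= C2%:E * l2_energy v)%E].

End StableVectors.

Section Multiresolution.
Context {R : realType}.
Implicit Types (V : int -> set (R -> R[i])).

Definition mra_properties V : Prop :=
  [/\ forall j : int, V j `<=` V (j + 1),
      L2closure (\bigcup_j V j) = L2,
      \bigcap_j V j =
        [set f | L2 f /\ {ae @lebesgue_measure R, forall x, f x = 0}],
      forall (j k : int) (f : R -> R[i]), L2 f ->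
        (V j f <-> V j (fun x => f (x - 2 ^ (- j) * k%:~R))) &
      forall (j : int) (f : R -> R[i]), L2 f ->
        (V j f <-> V (j + 1) (fun x => f (2 * x)))].

Definition multiscaling_function V (r : nat) (G : 'I_r -> R -> R[i]) : Prop :=
  L2_stable G /\
  V 0 = L2closure (linear_span
    [set g | exists (l : 'I_r) (k : int), g = (fun x => G l (x - k%:~R))]).

Definition multiresolution_analysis V : Prop :=
  [/\ forall j, closed_subspace (V j),
      mra_properties V &
      exists r : nat, (0 < r)%N /\
        exists G : 'I_r -> R -> R[i], multiscaling_function V G].

End Multiresolution.

Section Quarks.
Context {R : realType}.

(* The order m = 0 is a junk value. *)
Fixpoint bspline (m : nat) : R -> R :=
  match m with
  | 0%N => fun=> 0
  | 1%N => \1_(`[0, 1[%classic)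
  | m'.+1 => fun x =>
      \int[@lebesgue_measure R]_(t in `[0, 1]) bspline m' (x - t)
  end.

Definition quark (m p : nat) (x : R) : R :=
  (x / (uphalf m)%:R) ^+ p * bspline m (x + (m./2)%:R).

Definition quark_space (m p : nat) (j : int) : set (R -> R[i]) :=
  L2closure (linear_span
    [set g | exists (q : nat) (k : int), (q <= p)%N /\
       g = (fun x => (2 `^ (j%:~R / 2) * quark m q (2 ^ j * x - k%:~R))%:C)]).

End Quarks.

(* Main.v *)
Require Import Defs.
From mathcomp Require Import all_boot all_order all_algebra.
From mathcomp Require Import finmap complex.
From mathcomp Require Import all_classical all_reals all_analysis.
From mathcomp Require Import measurable_realfun.
From mathcomp.analysis.showcase Require Import summability.
From mathcomp Require Import ring lra zify.

(** The proof rests on two descriptions of the B-spline: the averaging recursion,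
    in which the spline of order m+1 is the mean of the spline of order m over a
    window of length one, and its restriction to an integer cell [i, i+1), which is
    a polynomial (bspline_piece).

    Inclusions and symmetries.  Each V_j is the closure of a span, and precomposing
    with an increasing affine map rescales the squared L_2 norm
    (L2closure_span_affine).  Hence every statement that compares two of these
    spaces, or a space with its translate or dilate, only has to be checked on
    generators.  For translations and dilations this is immediate; for the
    inclusion of V_j in V_(j+1) it is the refinement equation of the B-spline
    together with the binomial expansion of the power factor (quark_refinement).

    Density.  A block of consecutive translates of the B-spline sums to one inside
    the block, vanishes outside it and stays between zero and one (bblock_eq1), so
    that fine blocks converge in L_2 to indicators of intervals.  Dynkin's theorem
    carries this to indicators of bounded Borel sets, and monotone approximation by
    simple functions to all of L_2 (quark_space_dense).

    Trivial intersection.  On a unit cell an element of the span at level 0 is a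
    polynomial of bounded degree, so its sup norm is controlled by its L_2 norm
    (span_sup_bound).  If f lies in every V_j then f(2^n x) lies in V_0, and
    rescaling that estimate shows that the mass of f on a fixed bounded interval is
    at most a constant times 2^-n (quark_space_meet).

    Stability when m = 1 or p = 0.  The generators are bounded with compact support,
    so pointwise only boundedly many translates interact and the upper estimate is
    the Cauchy-Schwarz inequality (shift_sum_upper); the bi-infinite series is
    locally a finite sum, and Fatou's lemma carries the estimate to it and to its
    tails.  For the lower estimate, on each cell the series is a combination of
    finitely many linearly independent polynomials of degree less than their number:
    the monomials for m = 1, the pieces of the B-spline for p = 0 (bpiece_free).  The
    coefficients of such a combination are controlled by its L_2 norm on the cell
    (local_stability), and summing over the cells gives the global bound. *)

Set Implicit Arguments.
Unset Strict Implicit.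
Unset Printing Implicit Defensive.

Import Order.TTheory GRing.Theory Num.Theory.
Import numFieldNormedType.Exports.

Local Open Scope classical_set_scope.
Local Open Scope ring_scope.
Local Open Scope complex_scope.

(** * The squared norm, closures and spans *)

Section SquareNorm.
Context {R : realType}.
Local Notation mu := (@lebesgue_measure R).
Local Notation normc := ComplexField.Normc.normc.
Local Notation Re := complex.Re.
Local Notation Im := complex.Im.
Implicit Types (f g h : R -> R[i]) (S : set (R -> R[i])).

Lemma sqr_normc (z : R[i]) : normc z ^+ 2 = Re z ^+ 2 + Im z ^+ 2.
Proof. by case: z => a b /=; rewrite sqr_sqrtr// addr_ge0 ?sqr_ge0. Qed.

Lemma normc_ge0 (z : R[i]) : 0 <= normc z.
Proof. by case: z => a b; exact: sqrtr_ge0. Qed.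

Lemma sqr_normcD_le (z w : R[i]) :
  normc (z + w) ^+ 2 <= 2 * normc z ^+ 2 + 2 * normc w ^+ 2.
Proof.
rewrite !sqr_normc !raddfD/=; case: z w => a b [c d] /=.
have := sqr_ge0 (a - c); have := sqr_ge0 (b - d); nra.
Qed.

Definition cmeasurable f : Prop :=
  measurable_fun setT (fun x => Re (f x)) /\
  measurable_fun setT (fun x => Im (f x)).

Definition sqnorm f : \bar R := (\int[mu]_x (normc (f x) ^+ 2)%:E)%E.

Lemma sqnorm_ge0 f : (0 <= sqnorm f)%E.
Proof. by apply: integral_ge0 => x _; rewrite lee_fin sqr_ge0. Qed.

Lemma L2norm_sqr f : (L2norm f ^+ 2 = sqnorm f)%E.
Proof.
have h : (L2norm f `^ 2 = sqnorm f)%E.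
  rewrite /L2norm poweR_Lnorm//; apply: eq_integral => x _.
  by rewrite abse_EFin ger0_norm ?normc_ge0// poweR_EFin powR_mulrn ?normc_ge0.
rewrite -h; have : (0 <= L2norm f)%E by exact: Lnorm_ge0.
case: (L2norm f) => [r| |] //.
  by rewrite lee_fin => r0; rewrite poweR_EFin powR_mulrn// expr2 expe2 EFinM.
by rewrite poweRyr ?expe2 ?mulyy// lt0r_neq0.
Qed.

Lemma L2norm_lt f (e : R) : 0 < e ->
  (L2norm f < e%:E)%E = (sqnorm f < (e ^+ 2)%:E)%E.
Proof.
move=> e0; rewrite -L2norm_sqr.
have : (0 <= L2norm f)%E by exact: Lnorm_ge0.
case: (L2norm f) => [r| |] //; rewrite ?lee_fin => r0.
  by rewrite expe2 -EFinM !lte_fin -expr2 ltr_pXn2r// nnegrE ltW.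
Qed.

Lemma L2norm_lty f : (L2norm f < +oo)%E = (sqnorm f < +oo)%E.
Proof.
rewrite -L2norm_sqr.
have : (0 <= L2norm f)%E by exact: Lnorm_ge0.
by case: (L2norm f) => [r| |] // _; rewrite expe2 ?mulyy// -EFinM !ltry.
Qed.

Lemma L2P f : L2 f <-> cmeasurable f /\ (sqnorm f < +oo)%E.
Proof.
by rewrite /L2 /= L2norm_lty; split=> [[a b c]|[[a b] c]].
Qed.

Lemma measurable_sqr_normc f : cmeasurable f ->
  measurable_fun setT (fun x => normc (f x) ^+ 2).
Proof.
move=> [mr mi]; under eq_fun do rewrite sqr_normc.
by apply: measurable_funD; exact: measurable_funX.
Qed.

Lemma cmeasurableD f g : cmeasurable f -> cmeasurable g ->
  cmeasurable (fun x => f x + g x).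
Proof.
move=> [fr fi] [gr gi]; split.
  by under eq_fun do rewrite raddfD/=; exact: measurable_funD.
by under eq_fun do rewrite raddfD/=; exact: measurable_funD.
Qed.

Lemma cmeasurableM f g : cmeasurable f -> cmeasurable g ->
  cmeasurable (fun x => f x * g x).
Proof.
move=> [fr fi] [gr gi].
have E x : f x * g x = (Re (f x) * Re (g x) - Im (f x) * Im (g x)) +i*
   (Re (f x) * Im (g x) + Im (f x) * Re (g x)).
  by case: (f x) (g x) => a b [].
split; under eq_fun do rewrite E /=.
  by apply: measurable_funB; exact: measurable_funM.
by apply: measurable_funD; exact: measurable_funM.
Qed.

Lemma cmeasurable_cst (a : R[i]) : cmeasurable (fun=> a).
Proof. by split; exact: measurable_cst. Qed.

Lemma cmeasurable_real (u : R -> R) : measurable_fun setT u ->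
  cmeasurable (fun x => (u x)%:C).
Proof. by move=> mu; split => //=; exact: measurable_cst. Qed.

Lemma cmeasurableZ (a : R[i]) f : cmeasurable f ->
  cmeasurable (fun x => a * f x).
Proof. by apply: cmeasurableM; exact: cmeasurable_cst. Qed.

Lemma cmeasurableB f g : cmeasurable f -> cmeasurable g ->
  cmeasurable (fun x => f x - g x).
Proof.
move=> mf mg; under eq_fun do rewrite -mulN1r.
by apply: cmeasurableD => //; exact: cmeasurableZ.
Qed.

Lemma cmeasurable_comp f (phi : R -> R) : measurable_fun setT phi ->
  cmeasurable f -> cmeasurable (fun x => f (phi x)).
Proof.
move=> mphi [fr fi]; split.
  exact: (@measurableT_comp _ _ _ _ _ _ (fun x => Re (f x)) _ phi).
exact: (@measurableT_comp _ _ _ _ _ _ (fun x => Im (f x)) _ phi).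
Qed.

Lemma cmeasurable_sum I (r : seq I) (P : pred I) (F : I -> R -> R[i]) :
  (forall i, P i -> cmeasurable (F i)) ->
  cmeasurable (fun x => \sum_(i <- r | P i) F i x).
Proof.
move=> mF; elim: r => [|i r IH].
  by under eq_fun do rewrite big_nil; exact: cmeasurable_cst.
under eq_fun do rewrite big_cons.
by case: (boolP (P i)) => // Pi; apply: cmeasurableD => //; exact: mF.
Qed.

Lemma le_sqnorm f g : cmeasurable f -> cmeasurable g ->
  (forall x, normc (f x) ^+ 2 <= normc (g x) ^+ 2) -> (sqnorm f <= sqnorm g)%E.
Proof.
move=> mf mg fg; apply: ge0_le_integral => //.
- by move=> x _; rewrite lee_fin sqr_ge0.
- by apply/measurable_EFinP; exact: measurable_sqr_normc.
- by apply/measurable_EFinP; exact: measurable_sqr_normc.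
- by move=> x _; rewrite lee_fin.
Qed.

(** Weaker than the triangle inequality, but immediate from the pointwise estimate
    and without square roots, and strong enough for passing to limits. *)
Lemma sqnormD_le f g : cmeasurable f -> cmeasurable g ->
  (sqnorm (fun x => (f x + g x)%R) <= 2%:E * sqnorm f + 2%:E * sqnorm g)%E.
Proof.
move=> mf mg; rewrite /sqnorm.
have m2 h : cmeasurable h -> measurable_fun setT (fun x => (normc (h x) ^+ 2)%:E).
  by move=> mh; apply/measurable_EFinP; exact: measurable_sqr_normc.
have m2' h : cmeasurable h ->
    measurable_fun setT (fun x => (2%:E * (normc (h x) ^+ 2)%:E)%E).
  by move=> mh; apply: emeasurable_funM => //; exact: m2.
have p h x : (0 <= (normc (h x) ^+ 2)%:E)%E by rewrite lee_fin sqr_ge0.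
rewrite -!ge0_integralZl//; [|exact: m2|exact: m2].
rewrite -ge0_integralD//; [|by move=> *; rewrite mule_ge0|exact: m2'|
  by move=> *; rewrite mule_ge0|exact: m2'].
apply: ge0_le_integral => //.
- by move=> x _; rewrite lee_fin sqr_ge0.
- by apply: (m2 (fun x => f x + g x)); exact: cmeasurableD.
- by apply: emeasurable_funD; exact: m2'.
- by move=> x _; rewrite -!EFinM -EFinD lee_fin sqr_normcD_le.
Qed.

Lemma sqnormZ (a : R[i]) f : cmeasurable f ->
  sqnorm (fun x => a * f x) = ((normc a ^+ 2)%:E * sqnorm f)%E.
Proof.
move=> mf; rewrite /sqnorm -ge0_integralZl//.
- by apply: eq_integral => x _; rewrite ComplexField.Normc.normcM exprMn EFinM.
- by apply/measurable_EFinP; exact: measurable_sqr_normc.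
- by move=> x _; rewrite lee_fin sqr_ge0.
- by rewrite lee_fin sqr_ge0.
Qed.

Lemma sqnorm0 : sqnorm (fun=> 0) = 0%E.
Proof.
rewrite /sqnorm; under eq_integral do rewrite ComplexField.Normc.normc0 expr0n/=.
exact: integral0.
Qed.

Lemma sqnormC f g : sqnorm (fun x => f x - g x) = sqnorm (fun x => g x - f x).
Proof.
by rewrite /sqnorm; apply: eq_integral => x _; rewrite -(normcN (f x - g x)) opprB.
Qed.

Lemma L2_lin (a : R[i]) f g : L2 f -> L2 g -> L2 (fun x => a * f x + g x).
Proof.
move=> /L2P[mf Lf] /L2P[mg Lg]; apply/L2P; split.
  by apply: cmeasurableD => //; exact: cmeasurableZ.
apply: le_lt_trans (sqnormD_le (cmeasurableZ a mf) mg) _.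
rewrite sqnormZ//; apply: lte_add_pinfty; apply: lte_mul_pinfty => //.
by apply: lte_mul_pinfty => //; rewrite lee_fin sqr_ge0.
Qed.

Lemma L2_0 : L2 (fun=> 0 : R[i]).
Proof. by apply/L2P; split; [exact: cmeasurable_cst|rewrite sqnorm0 ltry]. Qed.

Lemma L2_sum n (c : 'I_n -> R[i]) (g : 'I_n -> R -> R[i]) :
  (forall i, L2 (g i)) -> L2 (fun x => \sum_(i < n) c i * g i x).
Proof.
elim: n c g => [|n IH] c g Lg.
  by under eq_fun do rewrite big_ord0; exact: L2_0.
by under eq_fun do rewrite big_ord_recl; apply: L2_lin => //; exact: IH.
Qed.

Lemma L2closureP S f : L2closure S f <->
  L2 f /\ forall e : R, 0 < e ->
    exists2 g, S g & (sqnorm (fun x => (f x - g x)%R) < e%:E)%E.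
Proof.
split=> -[Lf H]; split => // e e0.
  have [|g Sg] := H (Num.sqrt e); first by rewrite sqrtr_gt0.
  by rewrite L2norm_lt ?sqrtr_gt0// sqr_sqrtr ?ltW// => He; exists g.
have [|g Sg He] := H (e ^+ 2); first exact: exprn_gt0.
by exists g => //; rewrite L2norm_lt.
Qed.

Lemma L2closure_sub S : L2closure S `<=` L2.
Proof. by move=> f []. Qed.

Lemma sub_L2closure S : S `<=` L2 -> S `<=` L2closure S.
Proof.
move=> SL f Sf; apply/L2closureP; split; first exact: SL.
move=> e e0; exists f => //; rewrite (_ : (fun x => f x - f x) = fun=> 0).
  by rewrite sqnorm0 lte_fin.
by apply/funext => x; rewrite subrr.
Qed.

(** Two successive approximations are merged into one by the weak triangle
    inequality; this is what makes the closure idempotent. *)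
Lemma L2closure_approx S f : S `<=` L2 -> L2 f ->
  (forall e : R, 0 < e ->
     exists2 g, L2closure S g & (sqnorm (fun x => (f x - g x)%R) < e%:E)%E) ->
  L2closure S f.
Proof.
move=> SL Lf H; apply/L2closureP; split=> // e e0.
have e4 : 0 < e / 4 by rewrite divr_gt0.
have [g /L2closureP[Lg Hg] fg] := H _ e4.
have [h Sh gh] := Hg _ e4; exists h => //.
have /L2P[mf _] := Lf; have /L2P[mg _] := Lg; have /L2P[mh _] := SL _ Sh.
have -> : (fun x => f x - h x) = (fun x => (f x - g x) + (g x - h x)).
  by apply/funext => x; rewrite addrA subrK.
apply: le_lt_trans (sqnormD_le (cmeasurableB mf mg) (cmeasurableB mg mh)) _.
have -> : e%:E = (2%:E * (e / 4)%:E + 2%:E * (e / 4)%:E)%E.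
  by rewrite -!EFinM -EFinD; congr EFin; lra.
by rewrite lteD// lte_pmul2l.
Qed.

Lemma L2closureS S S' : S `<=` L2closure S' -> S' `<=` L2 ->
  L2closure S `<=` L2closure S'.
Proof.
move=> SS' S'L f /L2closureP[Lf H]; apply: L2closure_approx => // e e0.
by have [g Sg fg] := H e e0; exists g => //; exact: SS'.
Qed.

Lemma L2closure_idem S : S `<=` L2 -> L2closure (L2closure S) = L2closure S.
Proof.
move=> SL; apply/seteqP; split; first exact: L2closureS.
exact: sub_L2closure (@L2closure_sub S).
Qed.

Definition lin_closed S : Prop :=
  forall (a : R[i]) f g, S f -> S g -> S (fun x => a * f x + g x).

Lemma L2closure_lin S : S `<=` L2 -> lin_closed S -> lin_closed (L2closure S).
Proof.
move=> SL Slin a f g /L2closureP[Lf Hf] /L2closureP[Lg Hg].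
apply/L2closureP; split; first exact: L2_lin.
move=> e e0; set d := e / (4 * (normc a ^+ 2 + 1)).
have d0 : 0 < d by rewrite divr_gt0// mulr_gt0// ltr_wpDl// sqr_ge0.
have e4 : 0 < e / 4 by rewrite divr_gt0.
have [f' Sf' ff'] := Hf _ d0; have [g' Sg' gg'] := Hg _ e4.
exists (fun x => a * f' x + g' x); first exact: Slin.
have /L2P[mf _] := Lf; have /L2P[mg _] := Lg.
have /L2P[mf' _] := SL _ Sf'; have /L2P[mg' _] := SL _ Sg'.
have -> : (fun x => a * f x + g x - (a * f' x + g' x)) =
    (fun x => a * (f x - f' x) + (g x - g' x)).
  by apply/funext => x; ring.
apply: le_lt_trans.
  by apply: sqnormD_le; [apply: cmeasurableZ|]; exact: cmeasurableB.
rewrite sqnormZ; last exact: cmeasurableB.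
apply: (@le_lt_trans _ _ (2%:E * ((normc a ^+ 2)%:E * d%:E) +
   2%:E * sqnorm (fun x : R => (g x - g' x)%R))%E).
  by rewrite leeD2r// lee_pmul2l// lee_wpmul2l ?lee_fin ?sqr_ge0// ltW.
apply: (@lt_le_trans _ _ (2%:E * ((normc a ^+ 2)%:E * d%:E) +
   2%:E * (e/4)%:E)%E).
  by apply: lee_ltD => //; rewrite lte_pmul2l.
rewrite -!EFinM -EFinD lee_fin.
have : normc a ^+ 2 * d <= e / 4.
  rewrite /d mulrA ler_pdivrMr ?mulr_gt0 ?ltr_wpDl ?sqr_ge0//.
  have := sqr_ge0 (normc a); nra.
lra.
Qed.

Lemma lin_closed_sum S : S (fun=> 0) -> lin_closed S ->
  forall I (r : seq I) (P : pred I) (c : I -> R[i]) (F : I -> R -> R[i]),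
  (forall i, P i -> S (F i)) -> S (fun x => \sum_(i <- r | P i) c i * F i x).
Proof.
move=> S0 Sl I r P c F SF; elim: r => [|i r IH].
  by under eq_fun do rewrite big_nil.
under eq_fun do rewrite big_cons.
by case: (boolP (P i)) => // Pi; apply: Sl => //; exact: SF.
Qed.

Lemma linear_span_lin S : lin_closed (linear_span S).
Proof.
move=> a f g [n [c [u [Su ->]]]] [m [d [v [Sv ->]]]].
exists (n + m)%N, (fun i => match fintype.split i with inl j => a * c j | inr j => d j end),
  (fun i => match fintype.split i with inl j => u j | inr j => v j end); split.
  by move=> i; case: (fintype.split i).
apply/funext => x; rewrite big_split_ord/= mulr_sumr; congr (_ + _).
  apply: eq_bigr => i _; rewrite mulrA.
  by rewrite -[lshift m i]/(unsplit (inl i)) unsplitK.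
by apply: eq_bigr => i _; rewrite -[rshift n i]/(unsplit (inr i)) unsplitK.
Qed.

Lemma linear_span0 S : linear_span S (fun=> 0).
Proof.
exists 0%N, (fun _ => 0), (fun _ _ => 0); split; first by case.
by apply/funext => x; rewrite big_ord0.
Qed.

Lemma sub_linear_span S : S `<=` linear_span S.
Proof.
move=> f Sf; exists 1%N, (fun _ => 1), (fun _ => f); split=> //.
by apply/funext => x; rewrite big_ord1 mul1r.
Qed.

Lemma linear_span_min S S' : S `<=` S' -> S' (fun=> 0) -> lin_closed S' ->
  linear_span S `<=` S'.
Proof.
move=> SS' S0 Sl f [n [c [g [Sg ->]]]].
by apply: lin_closed_sum => // i _; exact: SS'.
Qed.

Lemma linear_span_L2 S : S `<=` L2 -> linear_span S `<=` L2.
Proof. by move=> SL f [n [c [g [Sg ->]]]]; apply: L2_sum => i; exact: SL. Qed.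

Lemma closed_subspace_closure_span S : S `<=` L2 ->
  closed_subspace (L2closure (linear_span S)).
Proof.
move=> SL; have SL' := linear_span_L2 SL; split.
- exact: L2closure_sub.
- exact: sub_L2closure (linear_span0 S).
- exact: L2closure_lin (@linear_span_lin S).
- exact: L2closure_idem.
Qed.

End SquareNorm.

(** * Affine changes of variable *)

Section AffineChange.
Context {R : realType}.
Local Notation mu := (@lebesgue_measure R).
Local Notation normc := ComplexField.Normc.normc.
Implicit Types (f g h : R -> R[i]) (S : set (R -> R[i])).

Lemma measurable_affine (a b : R) :
  measurable_fun setT (fun x : R => a * x + b).
Proof.
by apply: measurable_funD; [exact: measurable_funM|exact: measurable_cst].
Qed.

(** The image of Lebesgue measure under the affine map, multiplied by [a], agrees
    with Lebesgue measure on intervals, hence on Borel sets. *)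
Lemma ge0_integral_affine (a b : R) (u : R -> \bar R) : 0 < a ->
  measurable_fun setT u -> (forall x, (0 <= u x)%E) ->
  (\int[mu]_x u (a * x + b)%R = (a^-1)%:E * \int[mu]_x u x)%E.
Proof.
move=> a0 mu_ u0.
pose phi : R -> measurableTypeR R := fun x => a * x + b.
have mphi : measurable_fun setT phi by exact: measurable_affine.
have ai0 : 0 <= a by exact: ltW.
pose nu := mscale (NngNum ai0) (pushforward mu phi).
have nuE A : measurable A -> mu A = nu mphi A.
  apply: lebesgue_measure_unique => _ [[c d] _ <-].
  have pE : phi @^-1` `]c, d] = `](c - b) / a, (d - b) / a]%classic.
    apply/seteqP; split=> x /=; rewrite !in_itv/= ltr_pdivrMr// ler_pdivlMr//;
      by rewrite /phi ltrBlDr lerBrDr mulrC.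
  rewrite -[RHS]/(a%:E * mu (phi @^-1` `]c, d]))%E pE.
  rewrite !lebesgue_measure_itv/= !lte_fin ltr_pM2r ?invr_gt0// ltrD2r.
  case: ifPn => _; last by rewrite mule0.
  by rewrite -EFinM; congr EFin; field; rewrite gt_eqF.
have -> : (\int[mu]_x u x = \int[nu mphi]_x u x)%E.
  by apply: eq_measure_integral => //= A mA _; exact: nuE.
rewrite /nu ge0_integral_mscale//= ge0_integral_pushforward//=.
by rewrite muleA -EFinM mulVf ?gt_eqF// mul1e preimage_setT.
Qed.

Lemma sqnorm_affine (a b : R) f : 0 < a -> cmeasurable f ->
  sqnorm (fun x => f (a * x + b)) = ((a^-1)%:E * sqnorm f)%E.
Proof.
move=> a0 mf.
rewrite /sqnorm (ge0_integral_affine b (u := fun x => (normc (f x) ^+ 2)%:E))//.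
  by apply/measurable_EFinP; exact: measurable_sqr_normc.
by move=> x; rewrite lee_fin sqr_ge0.
Qed.

Lemma L2_affine (a b : R) f : 0 < a -> L2 f -> L2 (fun x => f (a * x + b)).
Proof.
move=> a0 /L2P[mf fy]; apply/L2P; split.
  by apply: cmeasurable_comp => //; exact: measurable_affine.
by rewrite sqnorm_affine// lte_mul_pinfty// lee_fin invr_ge0 ltW.
Qed.

(** Composition with an affine map is linear and multiplies the squared norm by
    a constant, so a statement about generators passes to the closed spans. *)
Lemma L2closure_span_affine (a b : R) S S' : 0 < a -> S `<=` L2 ->
  (forall g, S g -> linear_span S' (fun x => g (a * x + b))) ->
  forall f, L2closure (linear_span S) f ->
  L2closure (linear_span S') (fun x => f (a * x + b)).
Proof.
move=> a0 SL SS' f /L2closureP[Lf H]; apply/L2closureP; split.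
  exact: L2_affine.
move=> e e0; have [g Sg fg] := H _ (mulr_gt0 a0 e0).
exists (fun x => g (a * x + b)).
  case: Sg => n [c [u [Su ->]]].
  apply: lin_closed_sum => [||i _]; last exact: SS'.
    exact: linear_span0.
  exact: linear_span_lin.
have /L2P[mf _] := Lf; have /L2P[mg _] := linear_span_L2 SL Sg.
rewrite (sqnorm_affine b (f := fun x => f x - g x))//; last exact: cmeasurableB.
by rewrite -lte_pdivlMl ?invr_gt0// invrK -EFinM.
Qed.

Lemma L2closure_spanS S S' : S `<=` L2 -> S `<=` linear_span S' ->
  L2closure (linear_span S) `<=` L2closure (linear_span S').
Proof.
move=> SL SS' f Sf.
have := @L2closure_span_affine 1 0 S S' ltr01 SL.
have E (g : R -> R[i]) : (fun x => g (1 * x + 0)) = g.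
  by apply/funext => x; rewrite mul1r addr0.
move=> /(_ _ f Sf); rewrite E; apply => g; rewrite E; exact: SS'.
Qed.

End AffineChange.

(** * Integrals of polynomials and local stability *)

Section PolynomialIntegrals.
Context {R : realType}.
Local Notation mu := (@lebesgue_measure R).
Implicit Types (p q : {poly R}) (a b : R).

Definition pprim p : {poly R} :=
  \poly_(i < (size p).+1) (p`_i.-1 / i%:R).

Lemma coef_pprim p i : (pprim p)`_i = p`_i.-1 / i%:R.
Proof.
rewrite coef_poly; case: ltnP => // pi.
by case: i pi => // i pi; rewrite nth_default ?mul0r.
Qed.

Lemma deriv_pprim p : (pprim p)^`() = p.
Proof.
apply/polyP => i; rewrite coef_deriv coef_pprim /= -mulrnAr.
by rewrite -[_ *+ _]mulr_natr mulVf ?mulr1.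
Qed.

Lemma size_pprim p : (size (pprim p) <= (size p).+1)%N.
Proof. exact: size_poly. Qed.

Lemma pprim_at0 p : (pprim p).[0] = 0.
Proof. by rewrite horner_coef0 coef_pprim invr0 mulr0. Qed.

Lemma pprimD p q : pprim (p + q) = pprim p + pprim q.
Proof. by apply/polyP => i; rewrite coefD !coef_pprim coefD mulrDl. Qed.

Lemma pprimZ c p : pprim (c *: p) = c *: pprim p.
Proof. by apply/polyP => i; rewrite coefZ !coef_pprim coefZ mulrA. Qed.

Lemma pprim0 : pprim 0 = 0.
Proof. by apply/polyP => i; rewrite coef_pprim !coef0 mul0r. Qed.

Lemma integral_deriv p q a b : a <= b -> q^`() = p ->
  (\int[mu]_(x in `[a, b]) (p.[x])%:E = (q.[b] - q.[a])%:E)%E.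
Proof.
rewrite le_eqVlt => /predU1P[<- _|ab qp].
  by rewrite set_itv1 integral_set1 subrr.
rewrite EFinB; apply: continuous_FTC2 => //.
- by apply: continuous_subspaceT => x; exact: continuous_horner.
- split; first by move=> x _; exact: derivable_horner.
    by apply: cvg_at_right_filter; exact: continuous_horner.
  by apply: cvg_at_left_filter; exact: continuous_horner.
- move=> x _; rewrite derive1E.
  by have -> := @derive_val _ _ _ _ _ _ _ (is_derive_poly q x); rewrite qp.
Qed.

Definition pint a b p : R := (pprim p).[b] - (pprim p).[a].

Lemma pintE a b p : a <= b ->
  (\int[mu]_(x in `[a, b]) (p.[x])%:E = (pint a b p)%:E)%E.
Proof. by move=> ab; apply: integral_deriv => //; exact: deriv_pprim. Qed.

Lemma pintD a b p q : pint a b (p + q) = pint a b p + pint a b q.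
Proof. by rewrite /pint pprimD !hornerD; ring. Qed.

Lemma pintZ a b c p : pint a b (c *: p) = c * pint a b p.
Proof. by rewrite /pint pprimZ !hornerZ; ring. Qed.

Lemma pint_sum a b I (r : seq I) (P : pred I) (F : I -> {poly R}) :
  pint a b (\sum_(i <- r | P i) F i) = \sum_(i <- r | P i) pint a b (F i).
Proof.
apply: (big_morph (pint a b)); first exact: pintD.
by rewrite /pint pprim0 !horner0 subrr.
Qed.

Lemma pintC a b c : pint a b c%:P = c * (b - a).
Proof.
have E x : (pprim c%:P).[x] = c * x.
  have -> : pprim c%:P = c *: 'X.
    apply/polyP => i; rewrite coef_pprim coefZ coefX coefC.
    by case: i => [|[|i]] //=; rewrite ?invr0 ?divr1 ?mulr1 ?mulr0 ?mul0r.
  by rewrite hornerZ hornerX.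
by rewrite /pint !E; ring.
Qed.

Lemma pint_cat a b c p : pint a b p + pint b c p = pint a c p.
Proof. by rewrite /pint; ring. Qed.

Lemma pint_ge0 a b p : a <= b -> (forall x, 0 <= p.[x]) -> 0 <= pint a b p.
Proof.
move=> ab p0; rewrite -lee_fin -pintE//.
by apply: integral_ge0 => x _; rewrite lee_fin.
Qed.

(** The Cauchy-Schwarz inequality against the constant 1, obtained from the integral
    of the square of the difference between [p] and its integral. *)
Lemma pint_sqr a b p : a <= b -> b - a <= 1 ->
  pint a b p ^+ 2 <= pint a b (p ^+ 2).
Proof.
move=> ab ba1; set l := pint a b p.
have : 0 <= pint a b ((p - l%:P) ^+ 2).
  by apply: pint_ge0 => // x; rewrite horner_exp sqr_ge0.
have -> : (p - l%:P) ^+ 2 = p ^+ 2 + (- 2 * l) *: p + (l ^+ 2)%:P.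
  by rewrite -mul_polyC expr2 !polyCM polyCN polyC_natr expr2; ring.
rewrite !pintD pintZ pintC -/l; have := sqr_ge0 l; nra.
Qed.

Lemma pint_sub a b c d p : a <= b -> b <= c -> c <= d ->
  (forall x, 0 <= p.[x]) -> pint b c p <= pint a d p.
Proof.
move=> ab bc cd p0; rewrite -(pint_cat a b d) -(pint_cat b c d).
by rewrite addrCA lerDl addr_ge0// pint_ge0.
Qed.

End PolynomialIntegrals.

Section SumOfSquares.
Context {R : realFieldType}.

(** Expanding both sides into double sums, this is 2xy <= x^2 + y^2 termwise. *)
Lemma sqr_sum_le I (s : seq I) (x : I -> R) :
  (\sum_(i <- s) x i) ^+ 2 <= (size s)%:R * \sum_(i <- s) x i ^+ 2.
Proof.
have E : (\sum_(i <- s) x i) ^+ 2 = \sum_(i <- s) \sum_(j <- s) x i * x j.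
  by rewrite expr2 mulr_suml; apply: eq_bigr => i _; rewrite mulr_sumr.
have F : (size s)%:R * \sum_(i <- s) x i ^+ 2 =
    \sum_(i <- s) \sum_(j <- s) (x i ^+ 2 + x j ^+ 2) / 2.
  have cst (y : R) : \sum_(j <- s) y = (size s)%:R * y.
    by rewrite big_const_seq count_predT iter_addr_0 mulr_natl.
  under [RHS]eq_bigr do rewrite -mulr_suml big_split/= cst.
  by rewrite -mulr_suml big_split/= cst -mulr_sumr; field.
rewrite E F; apply: ler_sum => i _; apply: ler_sum => j _.
have := sqr_ge0 (x i - x j); nra.
Qed.

Lemma sqr_sum_ord_le n (x : 'I_n -> R) :
  (\sum_(i < n) x i) ^+ 2 <= n%:R * \sum_(i < n) x i ^+ 2.
Proof.
have := sqr_sum_le (index_enum 'I_n) x.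
by rewrite [index_enum _]unlock /= -enumT size_enum_ord.
Qed.

End SumOfSquares.

Section LocalStability.
Context {R : realType} (n : nat).
Local Notation mu := (@lebesgue_measure R).

Definition poly_free (A : 'I_n -> {poly R}) : Prop :=
  forall c : 'I_n -> R, \sum_(i < n) c i *: A i = 0 -> forall i, c i = 0.

(** The hypothesis makes the antiderivative take the same value at the n+1 points
    j/n, which is more than its degree allows unless it is constant.  Integrals over
    subintervals are used as functionals, rather than point values, because they
    are controlled by the L_2 norm. *)
Lemma pieces_determine (p : {poly R}) : (size p <= n)%N ->
  (forall j : 'I_n, pint (j%:R / n%:R) (j.+1%:R / n%:R) p = 0) -> p = 0.
Proof.
move=> sp H; rewrite -(deriv_pprim p).
suff -> : pprim p = 0 by rewrite deriv0.
(* the end points of the subintervals *)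
pose s := [seq i%:R / n%:R : R | i <- iota 0 n.+1].
have n0 : n = 0%N \/ (0 < n%:R :> R).
  by case: (n) => [|k]; [left|right; rewrite ltr0n].
case: n0 => [n0|n0].
  by move: sp; rewrite n0 leqn0 size_poly_eq0 => /eqP ->; exact: pprim0.
have rts i : (i <= n)%N -> (pprim p).[i%:R / n%:R] = 0.
  elim: i => [_|i IH lin]; first by rewrite mul0r pprim_at0.
  have := H (Ordinal lin); rewrite /pint /= => /eqP; rewrite subr_eq0 => /eqP ->.
  exact/IH/ltnW.
apply: (@roots_geq_poly_eq0 _ _ s).
- rewrite all_map; apply/allP => i; rewrite mem_iota ltnS => /= ilen.
  by apply/rootP; exact: rts.
- rewrite map_inj_uniq ?iota_uniq// => i j.
  by move/(mulIf (invr_neq0 (lt0r_neq0 n0)))/eqP; rewrite eqr_nat => /eqP.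
- by rewrite size_map size_iota; apply: leq_trans (size_pprim p) _.
Qed.

(** The integrals over the n subintervals of length 1/n form an invertible matrix on
    a free family of n polynomials of degree less than n; inverting it expresses
    the coefficients through quantities bounded by the L_2 norm. *)
Theorem local_stability (A : 'I_n -> {poly R}) :
  (forall i, (size (A i) <= n)%N) -> poly_free A ->
  exists2 C : R, 0 < C & forall c : 'I_n -> R,
   ((\sum_(i < n) c i ^+ 2)%:E <=
    C%:E * \int[mu]_(x in `[0%R, 1%R[) ((\sum_(i < n) c i * (A i).[x])%R ^+ 2)%:E)%E.
Proof.
move=> sA freeA.
pose lam (j : 'I_n) := @pint R (j%:R / n%:R) (j.+1%:R / n%:R).
pose L : 'M[R]_n := \matrix_(i, j) lam j (A i).
have Lunit : L \in unitmx.
  rewrite -row_free_unit -kermx_eq0; apply/eqP/row_matrixP => k; rewrite row0.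
  have /sub_kermxP := row_sub k (kermx L); set v := row k _ => vL.
  have : \sum_(i < n) v 0 i *: A i = 0.
    apply: pieces_determine.
      apply: (leq_trans (size_sum _ _ _)); apply/bigmax_leqP => i _.
      exact: leq_trans (size_scale_leq _ _) (sA i).
    move=> j; rewrite pint_sum.
    have /matrixP/(_ 0 j) := vL; rewrite mxE [RHS]mxE => vL0.
    rewrite -[RHS]vL0.
    by apply: eq_bigr => i _; rewrite pintZ [L _ _]mxE.
  move=> /freeA v0; apply/rowP => i; rewrite v0 mxE; done.
pose B := invmx L.
pose C := \sum_(i < n) n%:R * \sum_(j < n) B j i ^+ 2.
exists (C + 1).
  by rewrite ltr_wpDl// sumr_ge0// => i _; rewrite mulr_ge0// sumr_ge0// => j _;
    exact: sqr_ge0.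
move=> c; set p := \sum_(i < n) c i *: A i.
have pE x : \sum_(i < n) c i * (A i).[x] = p.[x].
  by rewrite horner_sum; apply: eq_bigr => i _; rewrite hornerZ.
have -> : (\int[mu]_(x in `[0%R, 1%R[)
     ((\sum_(i < n) c i * (A i).[x])%R ^+ 2)%:E = (pint 0 1 (p ^+ 2))%:E)%E.
  under eq_integral do rewrite pE -horner_exp.
  rewrite integral_itv_bndo_bndc ?pintE//.
  by apply/measurable_EFinP; exact: measurable_poly.
rewrite -EFinM lee_fin.
set I2 := pint 0 1 _.
have I20 : 0 <= I2 by apply: pint_ge0 => // x; rewrite horner_exp sqr_ge0.
have lamI (j : 'I_n) : lam j p ^+ 2 <= I2.
  have n0 : 0 < n%:R :> R by rewrite ltr0n (leq_ltn_trans _ (ltn_ord j)).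
  have h1 : j%:R / n%:R <= j.+1%:R / n%:R :> R by rewrite ler_pM2r ?invr_gt0// ler_nat.
  apply: (@le_trans _ _ (lam j (p ^+ 2))).
    apply: pint_sqr => //; rewrite -mulrBl -natrB// subSnn ler_pdivrMr// mul1r.
    by rewrite ler1n (leq_ltn_trans _ (ltn_ord j)).
  apply: pint_sub => //.
  - by rewrite ler_pdivrMr// mul1r ler_nat.
  - by move=> x; rewrite horner_exp sqr_ge0.
have cE i : c i = \sum_(j < n) lam j p * B j i.
  have : (\row_i c i) *m L *m B = \row_i c i by rewrite mulmxK.
  move=> /matrixP/(_ 0 i); rewrite !mxE => <-; apply: eq_bigr => j _.
  congr (_ * _); rewrite mxE /lam /p pint_sum; apply: eq_bigr => k _.
  by rewrite pintZ !mxE.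
apply: (@le_trans _ _ (C * I2)); last by rewrite ler_wpM2r// lerDl.
rewrite /C mulr_suml; apply: ler_sum => i _; rewrite cE.
apply: (le_trans (sqr_sum_ord_le _)).
rewrite -mulrA ler_wpM2l// mulr_suml; apply: ler_sum => j _.
by rewrite exprMn mulrC ler_wpM2l// sqr_ge0.
Qed.

End LocalStability.

(** * The polynomial pieces of the B-splines *)

Section BSplines.
Context {R : realType}.
Local Notation mu := (@lebesgue_measure R).

Lemma ge0_integral_affine_in (a b : R) (D : set R) (u : R -> \bar R) : 0 < a ->
  measurable D -> measurable_fun setT u -> (forall x, (0 <= u x)%E) ->
  (\int[mu]_(x in [set x | D (a * x + b)%R]) u (a * x + b)%R =
   (a^-1)%:E * \int[mu]_(x in D) u x)%E.
Proof.
move=> a0 mD mu_ u0.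
rewrite integral_mkcond [in RHS]integral_mkcond.
rewrite -(ge0_integral_affine b (u := u \_ D))//.
- by apply/(measurable_restrictT _ _).1 => //; exact: measurable_funTS.
- by move=> x; rewrite patchE; case: ifP.
Qed.

(** [bpiece m i] is the B-spline of order m+1 on [i, i+1) in the local variable.
    Averaging over a window of length one ending at i+y integrates the piece of
    index i over [0, y] and the preceding one over [y, 1], whence the recursion. *)
Fixpoint bpiece (m i : nat) : {poly R} :=
  if m is m'.+1 then
    let prev := if i is i'.+1 then bpiece m' i' else 0 in
    pprim (bpiece m' i) + ((pprim prev).[1])%:P - pprim prev
  else (i == 0%N)%:R%:P.

Arguments bpiece : simpl never.

Definition bprev (m i : nat) : {poly R} := if i is i'.+1 then bpiece m i' else 0.

Lemma bpieceS m i : bpiece m.+1 i =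
  pprim (bpiece m i) + ((pprim (bprev m i)).[1])%:P - pprim (bprev m i).
Proof. by []. Qed.

Lemma bpiece_gt m i : (m < i)%N -> bpiece m i = 0.
Proof.
elim: m i => [|m IH] [|i]// mi.
by rewrite bpieceS /bprev !IH ?(ltnW mi)// pprim0 horner0 subr0 add0r.
Qed.

Lemma size_bpiece m i : (size (bpiece m i) <= m.+1)%N.
Proof.
elim: m i => [|m IH] i; first exact: size_polyC_leq1.
have sprev : (size (bprev m i) <= m.+1)%N by case: i => [|i] //=; rewrite size_poly0.
rewrite bpieceS; apply: (leq_trans (size_polyD _ _)).
rewrite geq_max size_polyN; apply/andP; split.
  apply: (leq_trans (size_polyD _ _)); rewrite geq_max.
  rewrite (leq_trans (size_pprim _)) ?ltnS ?IH//=.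
  by rewrite (leq_trans (size_polyC_leq1 _)).
by rewrite (leq_trans (size_pprim _)).
Qed.

Lemma deriv_bpiece m i : (bpiece m.+1 i)^`() = bpiece m i - bprev m i.
Proof. by rewrite bpieceS derivB derivD derivC !deriv_pprim addr0. Qed.

(** The partition of unity: by the recursion the sum at order m+1 is the integral
    over [0, 1] of the sum at order m. *)
Lemma sum_bpiece m : \sum_(i < m.+1) bpiece m i = 1.
Proof.
elim: m => [|m IH]; first by rewrite big_ord1 /bpiece.
have psum k (F : nat -> {poly R}) :
    \sum_(i < k) pprim (F i) = pprim (\sum_(i < k) F i).
  by symmetry; apply: (big_morph pprim (@pprimD R)); exact: pprim0.
under eq_bigr do rewrite bpieceS.
rewrite sumrB big_split/= (psum _ (bpiece m)) (psum _ (bprev m)).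
have -> : \sum_(i < m.+2) bprev m i = \sum_(i < m.+1) bpiece m i.
  by rewrite big_ord_recl/= add0r.
have -> : \sum_(i < m.+2) bpiece m i = \sum_(i < m.+1) bpiece m i.
  by rewrite big_ord_recr/= bpiece_gt// addr0.
rewrite addrAC subrr add0r -rmorph_sum/= -horner_sum (psum _ (bprev m)).
rewrite big_ord_recl/= add0r IH.
have := @pintC R 0 1 1; rewrite /pint pprim_at0 subr0 mul1r subr0 => ->.
by [].
Qed.

(** By induction on the order: differentiating a vanishing combination gives one of
    the pieces of the previous order, with the differences of consecutive
    coefficients.  So all coefficients agree, and the partition of unity shows that
    the common value is zero. *)
Lemma bpiece_free m : poly_free (fun i : 'I_m.+1 => bpiece m i).
Proof.
suff H : forall c : nat -> R, \sum_(i < m.+1) c i *: bpiece m i = 0 ->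
    forall i, (i <= m)%N -> c i = 0.
  move=> c c0 i; rewrite -(inord_val i); apply: (H (fun j => c (inord j))).
    by rewrite -[RHS]c0; apply: eq_bigr => j _; rewrite inord_val.
  by rewrite -ltnS.
elim: m => [|m IH] c c0 i.
  rewrite leqn0 => /eqP ->; move: c0; rewrite big_ord1 /bpiece /=.
  by move/eqP; rewrite alg_polyC polyC_eq0 => /eqP.
(* the sums shorten because the pieces of index m+1 and -1 are zero *)
have d0 : \sum_(j < m.+1) (c j - c j.+1) *: bpiece m j = 0.
  have dc0 : (\sum_(j < m.+2) c j *: bpiece m.+1 j)^`() = 0 by rewrite c0 deriv0.
  rewrite -[RHS]dc0 raddf_sum.
  transitivity (\sum_(j < m.+2) (c j *: bpiece m j - c j *: bprev m j)); last first.
    by apply: eq_bigr => j _; rewrite -scalerBr -deriv_bpiece -derivZ.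
  rewrite sumrB [X in _ = X - _]big_ord_recr/= bpiece_gt// scaler0 addr0.
  rewrite [X in _ = _ - X]big_ord_recl/= scaler0 add0r -sumrB.
  by apply: eq_bigr => j _; rewrite scalerBl.
have cS j : (j <= m)%N -> c j.+1 = c j.
  by move=> jm; apply/esym/eqP; rewrite -subr_eq0 (IH (fun j => c j - c j.+1) d0).
have cE j : (j <= m.+1)%N -> c j = c 0%N.
  by elim: j => // j IHj jm; rewrite cS// IHj// ltnW.
move=> im; rewrite cE//; move: c0.
under eq_bigr => j _ do rewrite (cE j (ltn_ord j)).
rewrite -scaler_sumr sum_bpiece => /eqP.
by rewrite alg_polyC polyC_eq0 => /eqP.
Qed.

Local Notation N := (@bspline R).

Lemma bsplineS m x : N m.+2 x = \int[mu]_(t in `[0, 1]) N m.+1 (x - t).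
Proof. by []. Qed.

Arguments bspline : simpl never.

Lemma bspline1 x : N 1 x = \1_(`[0, 1[%classic) x.
Proof. by []. Qed.

Lemma bspline_ge0 m x : 0 <= N m x.
Proof.
case: m x => [|m] x //; elim: m x => [|m IH] x.
  by rewrite bspline1 indicE ler0n.
by rewrite bsplineS; apply: Rintegral_ge0.
Qed.

Lemma bspline_lt0 m x : x < 0 -> N m x = 0.
Proof.
case: m x => [|m] x //; elim: m x => [|m IH] x x0.
  by rewrite bspline1 indicE memNset//= in_itv/= leNgt x0.
rewrite bsplineS (@eq_Rintegral _ _ _ _ _ (fun=> 0)); first by rewrite Rintegral_cst// mul0r.
move=> t; rewrite inE/= in_itv/= => /andP[t0 _]; apply: IH.
by rewrite subr_lt0 (lt_le_trans x0).
Qed.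

(** Stated with the local description as a hypothesis, because the induction that
    proves this description has to integrate the spline of the previous order. *)
Lemma bspline_piece_measurable m :
  (forall (i : nat) y, 0 <= y < 1 -> N m.+1 (i%:R + y) = (bpiece m i).[y]) ->
  measurable_fun setT (N m.+1).
Proof.
move=> H.
have -> : N m.+1 = fun x => \sum_(i < m.+1)
    \1_(`[i%:R, i.+1%:R[%classic) x * (bpiece m i).[1 * x + - i%:R].
  apply/funext => x; have [x0|x0] := ltP x 0.
    rewrite bspline_lt0// big1// => i _.
    by rewrite indicE memNset ?mul0r//= in_itv/= leNgt (lt_le_trans x0).
  have /andP[tx xt] := truncn_itv x0.
  have [tm|mt] := ltnP (Num.truncn x) m.+1.
    rewrite (bigD1 (Ordinal tm))//= big1 ?addr0.
      rewrite indicE mem_set/= ?in_itv/= ?tx// mul1r mul1r.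
      rewrite -[in LHS](subrKC (Num.truncn x)%:R x) H// subr_ge0 tx/=.
      by rewrite ltrBlDl natr1.
    move=> i; rewrite -val_eqE/= => it; rewrite indicE memNset ?mul0r//=.
    rewrite in_itv/= => /truncn_def; move/eqP; rewrite eq_sym.
    by rewrite (negbTE it).
  rewrite big1.
    rewrite -(subrKC (Num.truncn x)%:R x) H ?bpiece_gt ?horner0// subr_ge0 tx/=.
    by rewrite ltrBlDl natr1.
  move=> i _; rewrite indicE memNset ?mul0r//= in_itv/= => /truncn_def e.
  by move: mt; rewrite e leqNgt ltn_ord.
apply: measurable_sum => i; apply: measurable_funM.
  exact: measurable_indic.
apply: (@measurableT_comp _ _ _ _ _ _ (horner (bpiece m i))).
  exact: measurable_poly.
exact: measurable_affine.
Qed.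

Lemma integral_poly_reflect (p : {poly R}) (a b z : R) : a <= b ->
  (\int[mu]_(t in `[a, b]) (p.[z - t])%:E =
   ((pprim p).[z - a] - (pprim p).[z - b])%:E)%E.
Proof.
move=> ab; pose w : {poly R} := z%:P - 'X.
have wE t : w.[t] = z - t by rewrite !hornerE.
under eq_integral do rewrite -wE -horner_comp.
rewrite (@integral_deriv _ _ (- (pprim p \Po w)))//.
  by rewrite !hornerN !horner_comp !wE; congr EFin; ring.
rewrite derivN deriv_comp deriv_pprim derivB derivC derivX sub0r.
by rewrite mulrN1 opprK.
Qed.

(** The window of averaging meets two cells, [i, i+1) for t <= y and the preceding one
    for t > y; the integral is split at t = y. *)
Lemma bspline_piece m (i : nat) y : 0 <= y < 1 ->
  N m.+1 (i%:R + y) = (bpiece m i).[y].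
Proof.
elim: m i y => [|m IH] i y /andP[y0 y1].
  rewrite /bpiece hornerC bspline1 indicE; congr (_%:R); apply/eqP.
  case: i => [|i] /=; first by rewrite add0r mem_set//= in_itv/= y0 y1.
  rewrite memNset//= in_itv/= => /andP[_]; rewrite -natr1.
  by have := ler0n R i; lra.
have mN := bspline_piece_measurable IH.
have mNx : measurable_fun setT (fun t : R => (N m.+1 (i%:R + y - t))%:E).
  apply/measurable_EFinP; apply: (measurableT_comp mN).
  by apply: measurable_funB => //; exact: measurable_cst.
rewrite bsplineS /Rintegral (@itv_bndbnd_setU _ _ _ (BRight y)) ?bnd_simp ?y0 ?(ltW y1)//.
rewrite ge0_integral_setU//=; first last.
- apply/disj_setPS => t [/=]; rewrite !in_itv/= => /andP[_ ty] /andP[].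
  by rewrite ltNge ty.
- by move=> t _; rewrite lee_fin bspline_ge0.
- exact: measurable_funTS.
have -> : (\int[mu]_(t in `[0%R, y]) (N m.+1 (i%:R + y - t)%R)%:E =
    \int[mu]_(t in `[0%R, y]) ((bpiece m i).[y - t])%:E)%E.
  apply: eq_integral => t; rewrite inE/= in_itv/= => /andP[t0 ty]; congr EFin.
  by rewrite -IH ?addrA//; apply/andP; split; lra.
have -> : (\int[mu]_(t in `]y, 1%R]) (N m.+1 (i%:R + y - t)%R)%:E =
    \int[mu]_(t in `]y, 1%R]) ((bprev m i).[(1 + y) - t])%:E)%E.
  apply: eq_integral => t; rewrite inE/= in_itv/= => /andP[yt t1]; congr EFin.
  case: i {mNx} => [|i] /=; first by rewrite horner0 bspline_lt0//; lra.
  rewrite -IH; last by apply/andP; split; lra.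
  by congr N; rewrite -natr1; ring.
rewrite integral_poly_reflect//.
rewrite integral_itv_obnd_cbnd; last first.
  apply/measurable_funTS/measurable_EFinP.
  apply: (measurableT_comp (@measurable_poly R (bprev m i) setT)).
  by apply: measurable_funB => //; exact: measurable_cst.
rewrite integral_poly_reflect ?(ltW y1)//= bpieceS !hornerE.
have -> : 1 + y - y = 1 by ring.
have -> : 1 + y - 1 = y by ring.
by rewrite subr0 subrr pprim_at0 subr0.
Qed.

Lemma measurable_bspline m : measurable_fun setT (N m).
Proof.
case: m => [|m]; first exact: measurable_cst.
exact: bspline_piece_measurable (@bspline_piece m).
Qed.

Lemma bspline_ge m x : m%:R <= x -> N m x = 0.
Proof.
case: m => [|m] // mx; have x0 : 0 <= x by rewrite (le_trans _ mx).
have /andP[tx xt] := truncn_itv x0.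
rewrite -(subrKC (Num.truncn x)%:R x) bspline_piece; last first.
  by rewrite subr_ge0 tx ltrBlDl natr1.
rewrite bpiece_gt ?horner0//.
by rewrite -ltnS -(@ltr_nat R) (le_lt_trans mx).
Qed.

End BSplines.
Arguments bspline : simpl never.
Arguments bpiece : simpl never.

(** * Blocks of translates and the refinement equation *)

Section BSplineIdentities.
Context {R : realType}.
Local Notation mu := (@lebesgue_measure R).
Local Notation N := (@bspline R).

Lemma integrable_bounded_reflect (g : R -> R) (M x : R) :
  measurable_fun setT g -> (forall y, `|g y| <= M) ->
  mu.-integrable `[0, 1] (EFin \o (fun t => g (x - t))).
Proof.
move=> mg gM; apply: measurable_bounded_integrable => //.
- by rewrite /= lebesgue_measure_itv/= lte_fin ltr01 -EFinB ltry.
- apply: measurable_funTS; apply: (measurableT_comp mg).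
  by apply: measurable_funB => //; exact: measurable_cst.
- exists M; split; first exact: num_real.
  by move=> K MK t _ /=; rewrite (le_trans (gM _))// ltW.
Qed.

Lemma Rintegral01_cst (c : R) : \int[mu]_(t in `[0, 1]) c = c.
Proof.
by rewrite Rintegral_cst//= lebesgue_measure_itv/= lte_fin ltr01 /= subr0 mulr1.
Qed.

Lemma bspline_le1 m x : N m x <= 1.
Proof.
case: m x => [|m] x; first exact: ler01.
elim: m x => [|m IH] x.
  by rewrite bspline1 indicE; case: (_ \in _).
rewrite bsplineS -[leRHS]Rintegral01_cst; apply: le_Rintegral => //.
  apply: (@integrable_bounded_reflect _ 1); first exact: measurable_bspline.
  by move=> y; rewrite ger0_norm ?bspline_ge0.
by apply: (@integrable_bounded_reflect (fun=> 1) 1 0) => // y; rewrite normr1.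
Qed.

Lemma normr_bspline m x : `|N m x| <= 1.
Proof. by rewrite ger0_norm ?bspline_ge0 ?bspline_le1. Qed.

(** The translates of index 0, ..., n-1, so that in order one this is the
    indicator of [0, n). *)
Definition bblock m n (x : R) : R := \sum_(i < n) N m (x - i%:R).

Lemma measurable_bblock m n : measurable_fun setT (bblock m n).
Proof.
apply: measurable_sum => i; apply: (measurableT_comp (measurable_bspline m)).
by apply: measurable_funB => //; exact: measurable_cst.
Qed.

Lemma bblock_ge0 m n x : 0 <= bblock m n x.
Proof. by apply: sumr_ge0 => i _; exact: bspline_ge0. Qed.

Lemma normr_bblock m n x : `|bblock m n x| <= n%:R.
Proof.
apply: (le_trans (ler_norm_sum _ _ _)).
apply: (@le_trans _ _ (\sum_(i < n) 1)); last by rewrite sumr_const card_ord.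
by apply: ler_sum => i _; exact: normr_bspline.
Qed.

Lemma bblockS m n x :
  bblock m.+2 n x = \int[mu]_(t in `[0, 1]) bblock m.+1 n (x - t).
Proof.
elim: n => [|n IH].
  rewrite /bblock big_ord0 (@eq_Rintegral _ _ _ _ _ (fun=> 0)).
    by rewrite Rintegral01_cst.
  by move=> t _; rewrite big_ord0.
rewrite /bblock big_ord_recr /= -[X in X + _]/(bblock _ _ _) IH bsplineS.
rewrite -RintegralD//.
- by apply: eq_Rintegral => t _; rewrite /bblock big_ord_recr/= addrAC.
- exact: integrable_bounded_reflect (measurable_bblock _ _) (@normr_bblock _ _).
- exact: integrable_bounded_reflect (measurable_bspline _) (@normr_bspline _).
Qed.

Lemma bblock_lt0 m n x : x < 0 -> bblock m n x = 0.
Proof.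
move=> x0; rewrite /bblock big1// => i _; apply: bspline_lt0.
by rewrite subr_lt0 (lt_le_trans x0).
Qed.

Lemma bblock_ge m n x : m%:R + n%:R <= x -> bblock m n x = 0.
Proof.
move=> x0; rewrite /bblock big1// => i _; apply: bspline_ge.
have : i%:R <= n%:R :> R by rewrite ler_nat ltnW.
lra.
Qed.

Lemma bblock1 n x : bblock 1 n x = \1_(`[0, n%:R[%classic) x.
Proof.
have E (y : R) (k : nat) : \1_(`[0, k%:R[%classic) y = (0 <= y < k%:R)%R%:R :> R.
  by rewrite indicE mem_setE in_itv.
have E1 (y : R) : N 1 y = (0 <= y < 1)%R%:R by rewrite bspline1 indicE mem_setE in_itv.
rewrite E; elim: n => [|n IH].
  by rewrite /bblock big_ord0; case: ltP => //; rewrite ?andbF// => y0; rewrite leNgt y0.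
rewrite /bblock big_ord_recr/= -[X in X + _]/(bblock _ _ _) IH E1.
rewrite subr_ge0 ltrBlDl natr1 -natr1.
have n0 := ler0n R n.
have [x0|x0] := leP 0 x; have [xn|xn] := ltP x n%:R => /=.
- by rewrite addr0 ltr_wpDr.
- by rewrite add0r.
- by rewrite addr0.
- by move: (le_lt_trans xn x0); rewrite ltNge n0.
Qed.

Lemma bblock_le1 m n x : bblock m.+1 n x <= 1.
Proof.
elim: m x => [|m IH] x; first by rewrite bblock1 indicE; case: (_ \in _).
rewrite bblockS -[leRHS]Rintegral01_cst; apply: le_Rintegral => //.
  exact: integrable_bounded_reflect (measurable_bblock _ _) (@normr_bblock _ _).
by apply: (@integrable_bounded_reflect (fun=> 1) 1 0) => // y; rewrite normr1.
Qed.

(** Translates of a B-spline form a partition of unity; a block of n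
    consecutive ones already sums to 1 away from the two ends. *)
Lemma bblock_eq1 m n x : m%:R <= x < n%:R -> bblock m.+1 n x = 1.
Proof.
elim: m x => [|m IH] x /andP[mx xn].
  by rewrite bblock1 indicE mem_set//= in_itv/= mx.
rewrite bblockS -[RHS]Rintegral01_cst; apply: eq_Rintegral => t.
rewrite inE/= in_itv/= => /andP[t0 t1]; apply: IH.
by move: mx; rewrite -natr1 => mx; apply/andP; split; lra.
Qed.

(** After the substitution u = 2t the window of length two is cut into two
    windows of length one, each of which is again a B-spline average. *)
Lemma Rintegral_dilate2 (g : R -> R) (z : R) : measurable_fun setT g ->
  (forall y, 0 <= g y <= 1) ->
  \int[mu]_(t in `[0, 1]) g (z - 2 * t) =
  2^-1 * (\int[mu]_(t in `[0, 1]) g (z - t) +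
          \int[mu]_(t in `[0, 1]) g (z - 1 - t)).
Proof.
move=> mg g01.
have g0 y : 0 <= g y by case/andP: (g01 y).
have gfin (w : R) : (\int[mu]_(t in `[0%R, 1%R]) (g (w - t)%R)%:E \is a fin_num)%E.
  apply: integrable_fin_num => //; apply: (@integrable_bounded_reflect _ 1) => // y.
  by rewrite ger0_norm//; case/andP: (g01 y).
have mgz (w : R) : measurable_fun setT (fun t : R => (g (w - t))%:E).
  apply/measurable_EFinP; apply: (measurableT_comp mg).
  by apply: measurable_funB => //; exact: measurable_cst.
have g0E (w : R) x : (0 <= (g (w - x)%R)%:E)%E by rewrite lee_fin.
suff H : (\int[mu]_(t in `[0%R, 1%R]) (g (z - 2 * t)%R)%:E =
    (2^-1)%:E * (\int[mu]_(t in `[0%R, 1%R]) (g (z - t)%R)%:E +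
                 \int[mu]_(t in `[0%R, 1%R]) (g (z - 1 - t)%R)%:E))%E.
  have fineMD (c : R) (u v : \bar R) : u \is a fin_num -> v \is a fin_num ->
      fine (c%:E * (u + v)) = c * (fine u + fine v) by case: u v => [u| |] [v| |].
  by rewrite /Rintegral H fineMD.
have -> : (\int[mu]_(t in `[0%R, 1%R]) (g (z - 2 * t)%R)%:E =
    \int[mu]_(t in [set t | `[0%R, 2%R]%classic (2 * t + 0)%R])
       (g (z - (2 * t + 0))%R)%:E)%E.
  have -> : [set t : R | `[0, 2]%classic (2 * t + 0)] = `[0, 1]%classic.
    by apply/seteqP; split=> t /=; rewrite !in_itv/= => /andP[? ?]; apply/andP; split; lra.
  by apply: eq_integral => t _; rewrite addr0.
rewrite (@ge0_integral_affine_in _ 2 0 `[0, 2]%classic (fun t => (g (z - t))%:E))//.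
congr (_ * _)%E.
rewrite (@itv_bndbnd_setU _ _ _ (BRight 1)) ?bnd_simp ?ler01 ?ler1n//.
rewrite ge0_integral_setU//=; first last.
- apply/disj_setPS => t [/=]; rewrite !in_itv/= => /andP[_ ty] /andP[].
  by move=> t1; have := lt_le_trans t1 ty; rewrite ltxx.
- by apply: measurable_funTS; exact: mgz.
congr (_ + _)%E; rewrite integral_itv_obnd_cbnd; last first.
  by apply: measurable_funTS; exact: mgz.
have -> : (\int[mu]_(t in `[0%R, 1%R]) (g (z - 1 - t)%R)%:E =
    \int[mu]_(t in [set t | `[1%R, 2%R]%classic (1 * t + 1)%R])
       (g (z - (1 * t + 1))%R)%:E)%E.
  have -> : [set t : R | `[1, 2]%classic (1 * t + 1)] = `[0, 1]%classic.
    by apply/seteqP; split=> t /=; rewrite !in_itv/= => /andP[? ?]; apply/andP; split; lra.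
  by apply: eq_integral => t _; congr (g _)%:E; ring.
rewrite (@ge0_integral_affine_in _ 1 1 `[1, 2]%classic (fun t => (g (z - t))%:E))//.
by rewrite invr1 mul1e.
Qed.

(** By induction on the order: averaging turns each term of the equation into two
    consecutive translates, and Pascal's rule collects them. *)
Lemma bspline_refinement m x :
  N m.+1 x = 2 ^- m * \sum_(k < m.+2) 'C(m.+1, k)%:R * N m.+1 (2 * x - k%:R).
Proof.
elim: m x => [|m IH] x.
  rewrite !big_ord_recl big_ord0 expr0 invr1 /= /bump /= bin0 binn !mul1r addr0 subr0.
  rewrite !bspline1 !indicE !mem_setE !in_itv/=.
  have [x0|x0] := leP 0 x; have [x1|x1] := ltP x 1;
  have [y0|y0] := leP 0 (2 * x); have [y1|y1] := ltP (2 * x) 1;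
  have [z0|z0] := leP 0 (2 * x - 1); have [z1|z1] := ltP (2 * x - 1) 1 => /=; lra.
have intN (w : R) k : mu.-integrable `[0, 1]
    (EFin \o (fun t => N m.+1 (2 * (x - t) - k%:R))).
  have := @integrable_bounded_reflect (fun y => N m.+1 (2 * y - k%:R)) 1 x.
  apply; last by move=> y; exact: normr_bspline.
  apply: (measurableT_comp (measurable_bspline _)).
  exact: measurable_affine.
have step k : \int[mu]_(t in `[0, 1]) N m.+1 (2 * (x - t) - k%:R) =
    2^-1 * (N m.+2 (2 * x - k%:R) + N m.+2 (2 * x - k.+1%:R)).
  have -> : 2 * x - k.+1%:R = 2 * x - k%:R - 1 by rewrite -natr1; ring.
  rewrite !bsplineS -Rintegral_dilate2.
  - by apply: eq_Rintegral => t _; congr N; ring.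
  - exact: measurable_bspline.
  - by move=> y; rewrite bspline_ge0 bspline_le1.
have lin K (c : nat -> R) : mu.-integrable `[0, 1]
    (EFin \o (fun t => \sum_(k < K) c k * N m.+1 (2 * (x - t) - k%:R))) /\
    \int[mu]_(t in `[0, 1]) (\sum_(k < K) c k * N m.+1 (2 * (x - t) - k%:R)) =
    \sum_(k < K) c k * \int[mu]_(t in `[0, 1]) N m.+1 (2 * (x - t) - k%:R).
  elim: K => [|K [IH1 IH2]].
    rewrite big_ord0; split.
      rewrite (_ : _ \o _ = fun=> 0%E); first exact: integrable0.
      by apply/funext => t; rewrite /= big_ord0.
    rewrite (@eq_Rintegral _ _ _ _ _ (fun=> 0)); first by rewrite Rintegral01_cst.
    by move=> t _; rewrite big_ord0.
  have i1 : mu.-integrable `[0, 1]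
      (EFin \o (fun t => c K * N m.+1 (2 * (x - t) - K%:R))).
    rewrite (_ : _ \o _ = fun t => ((c K)%:E * (N m.+1 (2 * (x - t) - K%:R))%:E)%E).
      by apply: integrableZl => //; exact: intN.
    by apply/funext => t /=; rewrite EFinM.
  split.
    rewrite (_ : _ \o _ = (fun t => (\sum_(k < K) c k * N m.+1 (2 * (x - t) - k%:R))%:E
        + (c K * N m.+1 (2 * (x - t) - K%:R))%:E)%E); first exact: integrableD.
    by apply/funext => t /=; rewrite big_ord_recr/= EFinD.
  rewrite big_ord_recr/= -IH2 -RintegralZl//; last exact: intN.
  rewrite -RintegralD//.
  by apply: eq_Rintegral => t _; rewrite big_ord_recr.
rewrite bsplineS; under eq_Rintegral do rewrite IH.
rewrite RintegralZl//; last exact: (lin _ (fun k => 'C(m.+1, k)%:R)).1.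
rewrite (lin _ (fun k => 'C(m.+1, k)%:R)).2.
under eq_bigr do rewrite step mulrCA mulrDr.
rewrite -mulr_sumr mulrA -invfM -exprSr; congr (_ * _).
rewrite big_split/= [in RHS]big_ord_recl/= bin0.
under [in RHS]eq_bigr do rewrite /bump/= add1n binS natrD mulrDl.
rewrite big_split/= addrA; congr (_ + _).
  rewrite big_ord_recl/= bin0; congr (_ + _).
  by rewrite [in RHS]big_ord_recr/= bin_small// mul0r addr0.
Qed.

End BSplineIdentities.

(** * Restriction to a set and limits *)

Section Cutting.
Context {R : realType}.
Local Notation mu := (@lebesgue_measure R).
Local Notation normc := ComplexField.Normc.normc.
Implicit Types (f g h : R -> R[i]) (D : set R).

Lemma normc_real (a : R) : normc a%:C ^+ 2 = a ^+ 2.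
Proof. by rewrite sqr_normc /= expr0n addr0. Qed.

Definition cut D f : R -> R[i] := fun x => (\1_D x)%:C * f x.

Lemma cmeasurable_cut D f : measurable D -> cmeasurable f -> cmeasurable (cut D f).
Proof.
by move=> mD mf; apply: cmeasurableM => //; apply: cmeasurable_real;
  exact: measurable_indic.
Qed.

Lemma sqr_normc_cut D f x : normc (cut D f x) ^+ 2 = \1_D x * normc (f x) ^+ 2.
Proof.
rewrite ComplexField.Normc.normcM exprMn normc_real; congr (_ * _).
by rewrite indicE; case: (_ \in _); rewrite ?expr1n ?expr0n.
Qed.

Lemma sqnorm_cut D f : measurable D -> sqnorm (cut D f) =
  (\int[mu]_(x in D) (normc (f x) ^+ 2)%:E)%E.
Proof.
move=> mD; rewrite /sqnorm [RHS]integral_mkcond; apply: eq_integral => x _.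
rewrite sqr_normc_cut patchE indicE; case: (_ \in _); first by rewrite mul1r.
by rewrite mul0r.
Qed.

Lemma sqnorm_cut_le D f : measurable D -> cmeasurable f ->
  (sqnorm (cut D f) <= sqnorm f)%E.
Proof.
move=> mD mf; apply: le_sqnorm => // [|x]; first exact: cmeasurable_cut.
rewrite sqr_normc_cut indicE; case: (_ \in _); first by rewrite mul1r.
by rewrite mul0r sqr_ge0.
Qed.

Lemma sqnorm_cut_bounded D f (M : \bar R) : measurable D -> cmeasurable f ->
  (0 <= M)%E -> (forall x, D x -> ((normc (f x) ^+ 2)%:E <= M)%E) ->
  (sqnorm (cut D f) <= M * mu D)%E.
Proof.
move=> mD mf M0 fM; rewrite sqnorm_cut// -integral_cst//.
apply: ge0_le_integral => //.
- by move=> x _; rewrite lee_fin sqr_ge0.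
- by apply/measurable_funTS/measurable_EFinP; exact: measurable_sqr_normc.
Qed.

(** Fatou's lemma: since the values at each point are eventually constant, the
    lower limit of the squared moduli is that of the limit function. *)
Lemma sqnorm_fatou (F : nat -> R -> R[i]) f (B : \bar R) :
  (forall n, cmeasurable (F n)) ->
  (forall x, exists n0, forall n, (n0 <= n)%N -> F n x = f x) ->
  (forall n, (sqnorm (F n) <= B)%E) -> (sqnorm f <= B)%E.
Proof.
move=> mF Ff FB.
have lim x : (normc (F n x) ^+ 2)%:E @[n --> \oo] --> (normc (f x) ^+ 2)%:E.
  have [n0 Hn0] := Ff x; apply: cvg_near_cst.
  by exists n0 => // n /= n0n; rewrite Hn0.
rewrite /sqnorm (_ : (fun x => _) = (fun x =>
    limn_einf (fun n => (normc (F n x) ^+ 2)%:E))); last first.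
  by apply/funext => x; rewrite (cvg_limn_einf_sup (lim x)).1.
apply: (@le_trans _ _ (limn_einf (fun n => sqnorm (F n)))).
  apply: fatou => // [n|n x _].
    by apply/measurable_EFinP; exact: measurable_sqr_normc.
  by rewrite lee_fin sqr_ge0.
rewrite limn_einf_lim; apply: lime_le; first exact: is_cvg_einfs.
near=> n; apply: (@le_trans _ _ (sqnorm (F n))) => //.
by apply: ereal_inf_lbound; exists n => /=.
Unshelve. all: by end_near. Qed.

Lemma cmeasurable_eventually (F : nat -> R -> R[i]) f :
  (forall n, cmeasurable (F n)) ->
  (forall x, exists n0, forall n, (n0 <= n)%N -> F n x = f x) -> cmeasurable f.
Proof.
move=> mF Ff; split.
- apply: (measurable_realfun.measurable_fun_cvg (h := fun n x => complex.Re (F n x))).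
    by move=> n; exact: (mF n).1.
  move=> x _; have [n0 Hn0] := Ff x; apply: cvg_near_cst.
  by exists n0 => // n /= n0n; rewrite Hn0.
- apply: (measurable_realfun.measurable_fun_cvg (h := fun n x => complex.Im (F n x))).
    by move=> n; exact: (mF n).2.
  move=> x _; have [n0 Hn0] := Ff x; apply: cvg_near_cst.
  by exists n0 => // n /= n0n; rewrite Hn0.
Qed.

(** Half open, like the supports of the quarks; these intervals exhaust the line. *)
Definition sym_itv (K : nat) : set R := `[- K%:R, K%:R[%classic.

Lemma measurable_sym_itv K : measurable (sym_itv K).
Proof. exact: measurable_itv. Qed.

Lemma lebesgue_sym_itv K : mu (sym_itv K) = (2 * K%:R)%:E.
Proof.
rewrite /sym_itv lebesgue_measure_itv/= lte_fin.
case: ltP => [_|]; first by rewrite -EFinB; congr EFin; ring.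
by move=> K0; congr EFin; have := ler0n R K; lra.
Qed.

Lemma sym_itv_exhaust x : exists n0, forall n, (n0 <= n)%N -> sym_itv n x.
Proof.
exists (Num.truncn `|x|).+1 => n xn.
have : `|x| < n%:R.
  by apply: lt_le_trans (truncnS_gt _) _; rewrite ler_nat.
by rewrite /sym_itv /= in_itv/= ltr_norml => /andP[/ltW -> ->].
Qed.

Lemma sqnorm_exhaust f (B : \bar R) : cmeasurable f ->
  (forall n, (sqnorm (cut (sym_itv n) f) <= B)%E) -> (sqnorm f <= B)%E.
Proof.
move=> mf H; apply: sqnorm_fatou H.
  by move=> n; apply: cmeasurable_cut => //; exact: measurable_sym_itv.
move=> x; have [n0 H0] := sym_itv_exhaust x; exists n0 => n /H0 xn.
by rewrite /cut indicE mem_set// mul1r.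
Qed.

(** The bound on the squared norm is kept in the statement because it gives the
    constant in the upper stability estimate. *)
Lemma L2_bounded (u : R -> R) (B : R) (K : nat) : measurable_fun setT u ->
  (forall x, `|u x| <= B) -> (forall x, ~ sym_itv K x -> u x = 0) ->
  (sqnorm (fun x => (u x)%:C) <= (B ^+ 2 * (2 * K%:R))%:E)%E /\
  L2 (fun x => (u x)%:C).
Proof.
move=> mu_ uB uK; have mc := cmeasurable_real mu_.
have le : (sqnorm (fun x => (u x)%:C) <= (B ^+ 2 * (2 * K%:R))%:E)%E.
  have -> : (fun x => (u x)%:C) = cut (sym_itv K) (fun x => (u x)%:C).
    apply/funext => x; rewrite /cut indicE.
    by case: (boolP (x \in _)); rewrite ?mul1r// notin_setE => /uK ->; rewrite mul0r.
  rewrite EFinM -lebesgue_sym_itv; apply: sqnorm_cut_bounded => //.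
  - exact: measurable_sym_itv.
  - by rewrite lee_fin sqr_ge0.
  - move=> x _; rewrite normc_real lee_fin -(real_normK (num_real (u x))).
    by rewrite lerXn2r// nnegrE// (le_trans _ (uB x)).
by split=> //; apply/L2P; split=> //; rewrite (le_lt_trans le) ?ltry.
Qed.

Lemma sqnorm_eq0 f : cmeasurable f -> sqnorm f = 0%E <->
  {ae mu, forall x, f x = 0}.
Proof.
move=> mf.
have m2 : measurable_fun setT (fun x => (normc (f x) ^+ 2)%:E).
  by apply/measurable_EFinP; exact: measurable_sqr_normc.
have E : sqnorm f = (\int[mu]_x `|(normc (f x) ^+ 2)%:E|)%E.
  by apply: eq_integral => x _; rewrite gee0_abs// lee_fin sqr_ge0.
have [H1 H2] := @ae_eq_integral_abs _ _ _ mu setT measurableT _ m2.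
rewrite E; split.
  move/H1; apply: (@filterS _ _ (ae_filter_ringOfSetsType mu)) => x /(_ I)/= [].
  move/eqP; rewrite sqrf_eq0 => /eqP.
  exact: ComplexField.Normc.eq0_normc.
move=> H; apply: H2; apply: (@filterS _ _ (ae_filter_ringOfSetsType mu)) H => x /= -> _.
by rewrite ComplexField.Normc.normc0 expr0n.
Qed.

End Cutting.

(** * The spaces generated by the quarks *)

Section QuarkSpaces.
Context {R : realType}.
Local Notation mu := (@lebesgue_measure R).
Local Notation normc := ComplexField.Normc.normc.
Local Notation N := (@bspline R).

Lemma measurable_quark m q : measurable_fun setT (@quark R m q).
Proof.
apply: measurable_funM.
  by apply: measurable_funX; exact: measurable_funM.
apply: (measurableT_comp (measurable_bspline m)).
by apply: measurable_funD => //; exact: measurable_cst.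
Qed.

Lemma quark_support m q x : ~ sym_itv m x -> @quark R m q x = 0.
Proof.
rewrite /sym_itv /= in_itv/= => xm; rewrite /quark.
have mh : (m./2)%:R <= m%:R :> R by rewrite ler_nat leq_half_double -addnn leqW// leq_addl.
have [x0|x0] := ltP (x + (m./2)%:R) 0; first by rewrite bspline_lt0// mulr0.
have [xm'|xm'] := leP m%:R (x + (m./2)%:R); first by rewrite bspline_ge// mulr0.
by exfalso; apply: xm; apply/andP; split; have := ler0n R (m./2); lra.
Qed.

Lemma normr_quark_le m q x : `|@quark R m q x| <= m%:R ^+ q.
Proof.
have [xm|xm] := pselect (sym_itv m x); last first.
  by rewrite quark_support// normr0 exprn_ge0.
rewrite /quark normrM -[leRHS]mulr1 ler_pM ?normr_bspline//.
rewrite normrX lerXn2r ?nnegrE//.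
move: xm; rewrite /sym_itv /= in_itv/= => /andP[xl xr].
have xm : `|x| <= m%:R by rewrite ler_norml xl ltW.
case: m xl xr xm => [|m] xl xr xm; first by rewrite invr0 mulr0 normr0.
rewrite normrM normfV normr_nat; apply: le_trans xm.
by rewrite ler_pdivrMr ?ltr0n// ler_peMr// ler1n.
Qed.

Definition quark_gens m p (j : int) : set (R -> R[i]) :=
  [set g | exists (q : nat) (k : int), (q <= p)%N /\
     g = (fun x => (2 `^ (j%:~R / 2) * @quark R m q (2 ^ j * x - k%:~R))%:C)].

Lemma quark_spaceE m p j :
  quark_space m p j = L2closure (linear_span (quark_gens m p j)).
Proof. by []. Qed.

Lemma L2_quark m q : L2 (fun x => (@quark R m q x)%:C).
Proof.
exact: (L2_bounded (measurable_quark m q) (@normr_quark_le m q) (@quark_support m q)).2.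
Qed.

Lemma expz2_gt0 (j : int) : 0 < 2 ^ j :> R.
Proof. exact: exprz_gt0. Qed.

Lemma quark_gens_L2 m p j : quark_gens m p j `<=` L2.
Proof.
move=> _ [q [k [_ ->]]].
have := L2_lin (2 `^ (j%:~R / 2))%:C
  (L2_affine (- k%:~R) (expz2_gt0 j) (L2_quark m q)) (@L2_0 R).
by congr L2; apply/funext => x; rewrite addr0 -rmorphM.
Qed.

(** The normalizing factor of a generator is invertible, hence irrelevant for the
    span. *)
Lemma span_quark m p j q (k : int) : (q <= p)%N ->
  linear_span (quark_gens m p j) (fun x => (@quark R m q (2 ^ j * x - k%:~R))%:C).
Proof.
move=> qp; pose c : R := 2 `^ (j%:~R / 2).
have c0 : c != 0 by rewrite gt_eqF// powR_gt0.
rewrite (_ : (fun x => _) = (fun x => (c^-1)%:C *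
    (c * @quark R m q (2 ^ j * x - k%:~R))%:C + 0)).
  apply: linear_span_lin; last exact: linear_span0.
  by apply: sub_linear_span; exists q, k.
by apply/funext => x; rewrite addr0 -rmorphM/= mulKf.
Qed.

Lemma span_quarkZ m p j q (k : int) (c : R) (g : R -> R[i]) : (q <= p)%N ->
  (forall x, g x = (c * @quark R m q (2 ^ j * x - k%:~R))%:C) ->
  linear_span (quark_gens m p j) g.
Proof.
move=> qp gE; rewrite (_ : g = fun x =>
    c%:C * (@quark R m q (2 ^ j * x - k%:~R))%:C + 0).
  by apply: linear_span_lin; [exact: span_quark|exact: linear_span0].
by apply/funext => x; rewrite gE addr0 rmorphM.
Qed.

Lemma closed_quark_space m p j : closed_subspace (@quark_space R m p j).
Proof. exact: closed_subspace_closure_span (@quark_gens_L2 m p j). Qed.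

(** The refinement equation of the B-spline together with the binomial expansion
    of the power factor around the translated argument. *)
Lemma quark_refinement m q y : @quark R m.+1 q y =
  \sum_(k < m.+2) \sum_(i < q.+1)
    (2 ^- m * 'C(m.+1, k)%:R * (2 ^- q * ((k%:R - (m.+1./2)%:R) / (uphalf m.+1)%:R) ^+ i
       * 'C(q, i)%:R)) *
    @quark R m.+1 (q - i) (2 * y - (k%:Z - (m.+1./2)%:Z)%:~R).
Proof.
rewrite {1}/quark bspline_refinement mulrCA !mulr_sumr; apply: eq_bigr => k _.
set s := (m.+1)./2; set u := (uphalf m.+1)%:R : R.
set z := 2 * y - (k%:Z - s%:Z)%:~R.
have zE : z = 2 * y - (k%:R - s%:R) by rewrite /z rmorphB.
have -> : y / u = 2^-1 * (z / u + (k%:R - s%:R) / u).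
  by rewrite -mulrDl zE subrK !mulrA mulVf// mul1r.
have -> : 2 * (y + s%:R) - k%:R = z + s%:R by rewrite zE; ring.
rewrite exprMn (exprDn _ ((k%:R - s%:R) / u)) exprVn.
rewrite mulr_sumr mulr_suml mulr_sumr; apply: eq_bigr => i _.
by rewrite /quark -/s -/u -[X in _ * (_ * X * _) = _]mulr_natr; ring.
Qed.

Lemma quark_space_nested m p j :
  (0 < m)%N -> @quark_space R m p j `<=` quark_space m p (j + 1).
Proof.
case: m => // m _; apply: L2closure_spanS; first exact: quark_gens_L2.
move=> _ [q [l [qp ->]]]; pose c : R := 2 `^ (j%:~R / 2).
rewrite (_ : (fun x => _) = (fun x => \sum_(k < m.+2) 1 *
   (\sum_(i < q.+1) (c * (2 ^- m * 'C(m.+1, k)%:R * (2 ^- q *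
     ((k%:R - (m.+1./2)%:R) / (uphalf m.+1)%:R) ^+ i * 'C(q, i)%:R)))%:C *
    (@quark R m.+1 (q - i) (2 ^ (j + 1) * x - (2 * l + k%:Z - (m.+1./2)%:Z)%:~R))%:C))).
  apply: lin_closed_sum; [exact: linear_span0|exact: linear_span_lin|move=> k _].
  apply: lin_closed_sum; [exact: linear_span0|exact: linear_span_lin|move=> i _].
  by apply: span_quark; rewrite (leq_trans _ qp)// leq_subr.
apply/funext => x; rewrite quark_refinement mulr_sumr rmorph_sum/=.
apply: eq_bigr => k _; rewrite mul1r mulr_sumr rmorph_sum/=.
apply: eq_bigr => i _; rewrite -rmorphM/=; congr (_%:C).
rewrite -[RHS]mulrA; congr (_ * (_ * quark _ _ _)).
by rewrite expfzDr// expr1z !rmorphB/= rmorphD/= rmorphM/=; ring.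
Qed.

Lemma quark_space_nested_le m p (j : int) (n : nat) :
  (0 < m)%N -> @quark_space R m p j `<=` quark_space m p (j + n%:Z).
Proof.
move=> m0; elim: n => [|n IH]; first by rewrite addr0.
by apply: subset_trans IH _; rewrite -[n.+1]addn1 PoszD addrA; exact: quark_space_nested.
Qed.

Lemma quark_space_translate m p (j k : int) (f : R -> R[i]) :
  quark_space m p j f -> quark_space m p j (fun x => f (x - 2 ^ (- j) * k%:~R)).
Proof.
move=> Vf.
rewrite (_ : (fun x => _) = (fun x => f (1 * x + (- (2 ^ (- j) * k%:~R))))).
  apply: L2closure_span_affine Vf; [by []|exact: quark_gens_L2|].
  move=> _ [q [l [qp ->]]]; apply: (@span_quarkZ _ _ _ q (k + l)) => // x.
  congr ((_ * quark _ _ _)%:C).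
  by rewrite mul1r mulrDr mulrN mulrA -expfzDr// subrr expr0z mul1r rmorphD/= opprD addrA.
by apply/funext => x; rewrite mul1r.
Qed.

Lemma quark_space_dilate m p (j n : int) (f : R -> R[i]) :
  quark_space m p j f -> quark_space m p (j + n) (fun x => f (2 ^ n * x)).
Proof.
move=> Vf; rewrite (_ : (fun x => _) = (fun x => f (2 ^ n * x + 0))).
  apply: L2closure_span_affine Vf; [exact: expz2_gt0|exact: quark_gens_L2|].
  move=> _ [q [l [qp ->]]]; apply: (@span_quarkZ _ _ _ q l) => // x.
  by congr ((_ * quark _ _ _)%:C); rewrite addr0 mulrA expfzDr.
by apply/funext => x; rewrite addr0.
Qed.

End QuarkSpaces.

(** * The intersection of the spaces *)

Section Intersection.
Context {R : realType}.
Local Notation mu := (@lebesgue_measure R).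
Local Notation normc := ComplexField.Normc.normc.
Local Notation N := (@bspline R).

Lemma monomials_free n : poly_free (fun i : 'I_n => 'X^i : {poly R}).
Proof.
move=> c c0 i; have := congr1 (fun p : {poly R} => p`_i) c0.
rewrite coef_sum coef0 (bigD1 i)//= coefZ coefXn eqxx mulr1 big1 ?addr0//.
by move=> j ji; rewrite coefZ coefXn eq_sym val_eqE (negbTE ji) mulr0.
Qed.

(** On [0, 1) the sup norm is at most the sum of the absolute values of the
    coefficients, which local stability of the monomials bounds by the L_2 norm. *)
Lemma poly_sup_bound n : exists2 C : R, 0 < C &
  forall (p : {poly R}) y, (size p <= n)%N -> 0 <= y < 1 ->
  (((p.[y]) ^+ 2)%:E <= C%:E * \int[mu]_(x in `[0%R, 1%R[) (p.[x] ^+ 2)%:E)%E.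
Proof.
have [||C C0 HC] := @local_stability R n (fun i => 'X^i).
- by move=> i; rewrite size_polyXn.
- exact: monomials_free.
exists (n%:R * C + 1) => [|p y sp /andP[y0 y1]].
  by rewrite ltr_wpDl// mulr_ge0// ltW.
have pE x : p.[x] = \sum_(i < n) p`_i * x ^+ i by rewrite (horner_coef_wide _ sp).
have := HC (fun i => p`_i).
under eq_integral do under eq_bigr do rewrite hornerXn.
under eq_integral do rewrite -pE.
set I := integral _ _ _ => HI.
have I0 : (0 <= I)%E by apply: integral_ge0 => x _; rewrite lee_fin sqr_ge0.
apply: (@le_trans _ _ ((n%:R * C)%:E * I)%E); last first.
  by rewrite lee_wpmul2r// lee_fin lerDl.
rewrite (EFinM n%:R C) -muleA.
apply: (@le_trans _ _ (n%:R%:E * (\sum_(i < n) p`_i ^+ 2)%:E)%E).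
  rewrite -EFinM lee_fin pE; apply: le_trans (sqr_sum_ord_le _) _.
  rewrite ler_wpM2l//; apply: ler_sum => i _.
  by rewrite exprMn ler_piMr ?sqr_ge0// -exprM exprn_ile1// ltW.
by rewrite lee_wpmul2l// lee_fin.
Qed.

(** A complex polynomial on each integer cell, given by its real and imaginary
    parts in the local variable. *)
Definition cell_poly n (u : R -> R[i]) : Prop :=
  forall k : int, exists P Q : {poly R}, [/\ (size P <= n)%N, (size Q <= n)%N &
    forall y, 0 <= y < 1 -> u (k%:~R + y) = P.[y] +i* Q.[y]].

Lemma bspline_cell m (k : int) : exists2 P : {poly R}, (size P <= m.+1)%N &
  forall y, 0 <= y < 1 -> N m.+1 (k%:~R + y) = P.[y].
Proof.
case: k => k.
  by exists (bpiece m k) => [|y y01]; [exact: size_bpiece|exact: bspline_piece].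
exists 0 => [|y /andP[y0 y1]]; first by rewrite size_poly0.
rewrite horner0 bspline_lt0// NegzE rmorphN/= -[k.+1%:~R]/(k.+1%:R) -natr1.
by have := ler0n R k; lra.
Qed.

Lemma span_cell_poly m p (u : R -> R[i]) :
  linear_span (quark_gens m.+1 p 0) u -> cell_poly (p + m).+1 u.
Proof.
apply: linear_span_min.
- move=> _ [q [l [qp ->]]] k; set s := (m.+1)./2; set w : R := (uphalf m.+1)%:R.
  have [B sB BE] := bspline_cell m (k - l + s%:Z).
  pose A : {poly R} := (w^-1 *: ('X + (k - l)%:~R%:P)) ^+ q.
  pose c : R := 2 `^ (0%:~R / 2).
  have sA : (size A <= q.+1)%N.
    apply: (leq_trans (size_poly_exp_leq _ _)); rewrite ltnS.
    have : (size (w^-1 *: ('X + (k - l)%:~R%:P)) <= 2)%N.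
      by rewrite (leq_trans (size_scale_leq _ _))// size_XaddC.
    by case: (size _) => [|[|[|]]]//= _; rewrite ?mul0n ?mul1n.
  exists (c *: (A * B)), 0; split; last 1 first.
  + move=> y y01; rewrite expr0z mul1r horner0.
    congr (_ +i* _); rewrite -/c hornerZ hornerM; congr (_ * _).
    rewrite /quark -/s -/w; congr (_ * _).
      rewrite horner_exp hornerZ !hornerE; congr (_ ^+ _).
      by rewrite rmorphB/=; ring.
    by rewrite -BE//; congr N; rewrite rmorphD rmorphB/=; ring.
  + apply: (leq_trans (size_scale_leq _ _)); apply: (leq_trans (size_polyMleq _ _)).
    move: sA sB qp; lia.
  + by rewrite size_poly0.
- by move=> k; exists 0, 0; split; rewrite ?size_poly0// => y _; rewrite horner0.
- move=> [a b] f g Hf Hg k.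
  have [P [Q [sP sQ fE]]] := Hf k; have [P' [Q' [sP' sQ' gE]]] := Hg k.
  have szD (A B : {poly R}) n : (size A <= n)%N -> (size B <= n)%N ->
      (size (A + B)%R <= n)%N.
    by move=> *; rewrite (leq_trans (size_polyD _ _))// geq_max; apply/andP.
  have szZ (A : {poly R}) (z : R) n : (size A <= n)%N -> (size (z *: A) <= n)%N.
    by move=> *; rewrite (leq_trans (size_scale_leq _ _)).
  exists (a *: P + - b *: Q + P'), (a *: Q + b *: P + Q'); split.
  + by apply: (szD) => //; apply: (szD) => //; apply: szZ.
  + by apply: (szD) => //; apply: (szD) => //; apply: szZ.
  + move=> y y01; rewrite fE// gE// !hornerE.
    by congr (_ +i* _); ring.
Qed.

Lemma sqnorm_shift_cell (u : R -> R[i]) (k : int) : cmeasurable u ->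
  (\int[mu]_(x in `[0%R, 1%R[) (normc (u (k%:~R + x)%R) ^+ 2)%:E <= sqnorm u)%E.
Proof.
move=> mu_.
have E : (fun x => u (k%:~R + x)) = (fun x => u (1 * x + k%:~R)).
  by apply/funext => x; rewrite mul1r addrC.
have mk : cmeasurable (fun x => u (k%:~R + x)).
  by rewrite E; apply: cmeasurable_comp => //; exact: measurable_affine.
rewrite -(sqnorm_cut (fun x => u (k%:~R + x)))//.
apply: (le_trans (sqnorm_cut_le _ _)) => //.
by rewrite E sqnorm_affine// invr1 mul1e.
Qed.

(** On a unit cell the functions in the span at level 0 are polynomials of bounded
    degree, so their sup norm is dominated by their L_2 norm. *)
Lemma span_sup_bound m p : exists2 C : R, 0 < C & forall u : R -> R[i],
  linear_span (quark_gens m.+1 p 0) u ->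
  forall x, ((normc (u x) ^+ 2)%:E <= C%:E * sqnorm u)%E.
Proof.
have [C C0 HC] := poly_sup_bound (p + m).+1.
exists C => // u Su x.
have /L2P[mu_ _] := linear_span_L2 (@quark_gens_L2 R m.+1 p 0) Su.
pose k := Num.floor x; pose y := x - k%:~R.
have y01 : 0 <= y < 1.
  by have := floor_itv x; rewrite -/k intrD1 /y subr_ge0 ltrBlDl.
have [P [Q [sP sQ uE]]] := span_cell_poly Su k.
have -> : x = k%:~R + y by rewrite /y addrC subrK.
rewrite uE// sqr_normc/= EFinD.
apply: (@le_trans _ _ (C%:E * \int[mu]_(x in `[0%R, 1%R[) (P.[x] ^+ 2)%:E +
    C%:E * \int[mu]_(x in `[0%R, 1%R[) (Q.[x] ^+ 2)%:E)%E).
  by apply: leeD; exact: HC.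
rewrite -muleDr; last 2 first.
- by [].
- by apply: ge0_adde_def; rewrite inE; apply: integral_ge0 => z _; rewrite lee_fin sqr_ge0.
have mp (A : {poly R}) :
    measurable_fun (`[0, 1[%classic : set R) (fun x : R => (A.[x] ^+ 2)%:E).
  by apply/measurable_EFinP; apply: measurable_funX; exact: measurable_poly.
rewrite -ge0_integralD//; [|by move=> z _; rewrite lee_fin sqr_ge0|exact: mp|
  by move=> z _; rewrite lee_fin sqr_ge0|exact: mp].
rewrite lee_pmul2l//; apply: le_trans (sqnorm_shift_cell k mu_).
rewrite le_eqVlt; apply/orP; left; apply/eqP; apply: eq_integral => z.
rewrite inE/= in_itv/= => z01.
by rewrite uE// sqr_normc -EFinD.
Qed.

(** Integrate the sup bound over [D] for an element of the span, then approximate;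
    the factor 4 comes from two uses of the weak triangle inequality. *)
Lemma quark_space_local_mass m p : exists2 C : R, 0 < C &
  forall (u : R -> R[i]) (D : set R), measurable D -> (mu D < +oo)%E ->
  quark_space m.+1 p 0 u ->
  (sqnorm (cut D u) <= C%:E * mu D * sqnorm u)%E.
Proof.
have [C C0 HC] := span_sup_bound m p.
exists (4 * C) => [|u D mD Dfin /L2closureP[Lu Hu]]; first by rewrite mulr_gt0.
have /L2P[mu_ uy] := Lu.
have Dd : (mu D \is a fin_num)%E by rewrite ge0_fin_numE.
have ud : sqnorm u \is a fin_num by rewrite ge0_fin_numE// sqnorm_ge0.
set d := fine (mu D); set a := fine (sqnorm u).
have dE : mu D = d%:E by rewrite fineK.
have aE : sqnorm u = a%:E by rewrite fineK.
have d0 : 0 <= d by rewrite fine_ge0.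
rewrite dE aE -!EFinM; apply/lee_addgt0Pr => e e0.
(* the choice that makes the accumulated error exactly e *)
pose t := e / (2 + 4 * C * d).
have den0 : 0 < 2 + 4 * C * d.
  by rewrite ltr_wpDr// mulr_ge0// mulr_ge0// ltW.
have t0 : 0 < t by rewrite divr_gt0.
have [g Sg ug] := Hu _ t0.
have /L2P[mg gy] := linear_span_L2 (@quark_gens_L2 R m.+1 p 0) Sg.
have mug : cmeasurable (fun x => u x - g x) by exact: cmeasurableB.
have gle : (sqnorm g <= (2 * a + 2 * t)%:E)%E.
  have -> : g = fun x => u x + (g x - u x) by apply/funext => x; rewrite addrC subrK.
  apply: le_trans (sqnormD_le _ _) _ => //; first exact: cmeasurableB.
  by rewrite aE (EFinD (2 * a)) (EFinM 2 a) (EFinM 2 t) leeD2l// lee_pmul2l// sqnormC ltW.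
have -> : cut D u = fun x => cut D (fun x => u x - g x) x + cut D g x.
  by apply/funext => x; rewrite /cut -mulrDr subrK.
apply: le_trans (sqnormD_le _ _) _; [exact: cmeasurable_cut|exact: cmeasurable_cut|].
apply: (@le_trans _ _ (2%:E * t%:E + 2%:E * (C * (2 * a + 2 * t) * d)%:E)%E).
  apply: leeD; rewrite lee_pmul2l//.
    by apply: le_trans (ltW ug); exact: sqnorm_cut_le.
  rewrite (EFinM _ d) -dE; apply: sqnorm_cut_bounded => //.
    rewrite lee_fin mulr_ge0 ?(ltW C0)//.
    by rewrite -lee_fin; apply: le_trans gle; exact: sqnorm_ge0.
  move=> x _; apply: (le_trans (HC g Sg x)).
  by rewrite (EFinM C) lee_pmul2l.
rewrite -!EFinM -!EFinD lee_fin.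
have -> : e = t * (2 + 4 * C * d) by rewrite /t divfK// gt_eqF.
by rewrite le_eqVlt; apply/orP; left; apply/eqP; ring.
Qed.

(** The dilate f(2^n x) lies in V_0 and has squared norm 2^-n times that of f, while
    the interval [-K, K) shrinks to one of length 2K 2^-n.  Undoing the dilation
    costs only one factor 2^n, so the mass of f on [-K, K) is O(2^-n). *)
Lemma quark_space_meet m p (f : R -> R[i]) : (0 < m)%N ->
  (forall j, quark_space m p j f) -> sqnorm f = 0%E.
Proof.
case: m => // m _ Vf.
have [C C0 HC] := quark_space_local_mass m p.
have Lf : L2 f by have [] := Vf 0.
have /L2P[mf fy] := Lf.
have ff : sqnorm f \is a fin_num by rewrite ge0_fin_numE// sqnorm_ge0.
set a := fine (sqnorm f); have aE : sqnorm f = a%:E by rewrite fineK.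
have a0 : 0 <= a by rewrite fine_ge0// sqnorm_ge0.
apply/eqP; rewrite eq_le sqnorm_ge0 andbT; apply: sqnorm_exhaust => // K.
apply/lee_addgt0Pr => e e0; rewrite add0e.
pose b := C * (2 * K%:R) * a.
have b0 : 0 <= b by rewrite !mulr_ge0// ltW.
have [n bn] : exists n : nat, b < e * 2 ^+ n.
  exists (Num.truncn (b / e)).+1; rewrite -ltr_pdivrMl// mulrC.
  apply: lt_trans (truncnS_gt _) _; rewrite -natrX ltr_nat.
  exact: ltn_expl.
pose c : R := 2 ^ n%:Z.
have c0 : 0 < c by exact: expz2_gt0.
have Vc : quark_space m.+1 p 0 (fun x => f (c * x)).
  by rewrite -(subrr n%:Z) addrC; apply: quark_space_dilate; exact: Vf.
pose D : set R := [set x | sym_itv K (c * x + 0)].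
have DE : D = `[- (K%:R / c), K%:R / c[%classic.
  apply/seteqP; split => x; rewrite /D /sym_itv /= !in_itv/= addr0 => /andP[h1 h2].
    by rewrite -mulNr ler_pdivrMr// ltr_pdivlMr// mulrC h1.
  by move: h1 h2; rewrite -mulNr ler_pdivrMr// ltr_pdivlMr// mulrC => -> ->.
have mD : measurable D by rewrite DE.
have muD : mu D = (2 * K%:R / c)%:E.
  rewrite DE lebesgue_measure_itv/= lte_fin; case: ltP => [_|].
    by rewrite -EFinB; congr EFin; ring.
  have : 0 <= K%:R / c by rewrite divr_ge0// ltW.
  by move=> h1 h2; congr EFin; rewrite -mulrA; lra.
have := HC _ D mD; rewrite muD => /(_ _ (ltry _) Vc).
have -> : cut D (fun x => f (c * x)) = fun x => cut (sym_itv K) f (c * x + 0).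
  apply/funext => x; rewrite /cut.
  have -> : \1_D x = \1_(sym_itv K) (c * x + 0) :> R.
    by rewrite !indicE; congr ((nat_of_bool _)%:R); apply/idP/idP; rewrite !inE.
  by rewrite addr0.
have -> : (fun x => f (c * x)) = (fun x => f (c * x + 0)).
  by apply/funext => x; rewrite addr0.
rewrite !sqnorm_affine//; last first.
  by apply: cmeasurable_cut => //; exact: measurable_sym_itv.
rewrite aE lee_pdivrMl// -!EFinM => h; apply: (le_trans h).
rewrite lee_fin (_ : c * _ = b / c); last by rewrite /b; field; rewrite gt_eqF.
by rewrite ler_pdivrMr// ltW.
Qed.

End Intersection.

(** * The union of the spaces is dense *)

Section Density.
Context {R : realType}.
Local Notation mu := (@lebesgue_measure R).
Local Notation normc := ComplexField.Normc.normc.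
Local Notation N := (@bspline R).

(** Dominated convergence, in the form in which it enlarges the class of functions
    known to lie in a closure. *)
Lemma L2closure_dominated (S : set (R -> R[i])) (u_ : nat -> R -> R) (u g : R -> R) :
  S `<=` L2 -> (forall n, measurable_fun setT (u_ n)) ->
  measurable_fun setT u -> measurable_fun setT g ->
  (forall x, u_ n x @[n --> \oo] --> u x) ->
  (forall n x, `|u_ n x| <= g x) -> (forall x, `|u x| <= g x) ->
  (\int[mu]_x (g x ^+ 2)%:E < +oo)%E ->
  (forall n, L2closure S (fun x => (u_ n x)%:C)) -> L2closure S (fun x => (u x)%:C).
Proof.
move=> SL mseq mlim mg cu leu_ leu gy Su_.
have g0 x : 0 <= g x by rewrite (le_trans _ (leu x)).
have sq_le (a b : R) : `|a| <= b -> a ^+ 2 <= b ^+ 2.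
  by move=> ab; rewrite -(real_normK (num_real a)) lerXn2r ?nnegrE// (le_trans _ ab).
have m2 (w : R -> R) : measurable_fun setT w ->
    measurable_fun setT (fun x => (w x ^+ 2)%:E).
  by move=> mw; apply/measurable_EFinP; exact: measurable_funX.
apply: L2closure_approx => //.
  apply/L2P; split; first exact: cmeasurable_real.
  apply: le_lt_trans gy; apply: ge0_le_integral => //.
  - by move=> x _; rewrite lee_fin sqr_ge0.
  - by apply/measurable_EFinP; apply: measurable_sqr_normc; exact: cmeasurable_real.
  - exact: m2.
  - by move=> x _; rewrite normc_real lee_fin sq_le.
move=> e e0.
pose d n x := ((u x - u_ n x) ^+ 2)%:E.
have md n : measurable_fun setT (d n) by apply: m2; exact: measurable_funB.
have d0 n x : (0 <= d n x)%E by rewrite lee_fin sqr_ge0.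
have cd : (\int[mu]_x d n x)%E @[n --> \oo] --> (0 : \bar R).
  rewrite -[X in _ --> X](integral0 mu setT).
  apply: (@dominated_cvg _ _ _ mu setT measurableT d _
      (fun x => (4 * g x ^+ 2)%:E)) => //.
  - move=> x _; apply: cvg_EFin; first by apply: nearW => n.
    rewrite /d /comp /=.
    have h : (u x - u_ n x) @[n --> \oo] --> u x - u x.
      by apply: cvgB; [exact: cvg_cst|exact: cu].
    have hh := cvgM h h; rewrite subrr mulr0 in hh.
    by under eq_fun do rewrite expr2; exact: hh.
  - apply/integrableP; split.
      apply/measurable_EFinP; apply: measurable_funM => //.
      exact: measurable_funX.
    under eq_integral do rewrite gee0_abs ?lee_fin ?mulr_ge0 ?sqr_ge0// EFinM.
    rewrite ge0_integralZl//; first by rewrite lte_mul_pinfty.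
      exact: m2.
    by move=> x _; rewrite lee_fin sqr_ge0.
  - move=> n x _; rewrite gee0_abs// lee_fin.
    have -> : 4 * g x ^+ 2 = (g x + g x) ^+ 2 by ring.
    by apply: sq_le; rewrite (le_trans (ler_normB _ _))// lerD.
have := cd; move/fine_cvgP => [_ /cvgrPdist_lt/(_ e e0)].
have := cd; move=> /fine_cvgP[finn _].
move=> hd; have [n _ /(_ _ (leqnn _))[fn hn]] := filterI finn hd.
exists (fun x => (u_ n x)%:C); first exact: Su_.
rewrite (_ : sqnorm _ = (\int[mu]_x d n x)%E); last first.
  by apply: eq_integral => x _; rewrite -rmorphB normc_real.
move: hn; rewrite /= sub0r normrN -lte_fin ger0_norm ?fineK//.
by rewrite fine_ge0// integral_ge0.
Qed.

(** Half open on the left, to match the intervals that generate the Borel sets. *)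
Definition cells (K : nat) : set R := `]- K%:R, K%:R]%classic.

Definition quark_union m p : set (R -> R[i]) := \bigcup_j @quark_space R m p j.

Lemma quark_union_L2 m p : quark_union m p `<=` L2.
Proof. by move=> f [j _ []]. Qed.

(** The union of the spaces is a subspace because they are nested. *)
Lemma quark_union_lin m p : (0 < m)%N -> lin_closed (quark_union m p).
Proof.
move=> m0 a f g [i _ Vf] [j _ Vg].
wlog ij : i j f g Vf Vg / (i <= j)%R => [H|].
  have [ij|ji] := leP i j; first exact: (H i j).
  exists i => //; have [_ _ lin _] := closed_quark_space m p i (R := R).
  apply: lin => //; have -> : i = j + `|i - j|%N%:Z.
    by rewrite gez0_abs ?subr_ge0 ?ltW// subrKC.
  exact: quark_space_nested_le.
exists j => //; have [_ _ lin _] := closed_quark_space m p j (R := R).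
apply: lin => //; have -> : j = i + `|j - i|%N%:Z.
  by rewrite gez0_abs ?subr_ge0// subrKC.
exact: quark_space_nested_le.
Qed.

Lemma quark_closure_lin m p : (0 < m)%N ->
  lin_closed (L2closure (quark_union m p)).
Proof. by move=> m0; apply: L2closure_lin (@quark_union_L2 m p) (quark_union_lin m0). Qed.

Lemma quark_closure0 m p : L2closure (quark_union m p) (fun=> 0).
Proof.
apply: sub_L2closure (@quark_union_L2 m p) _ _; exists 0 => //.
by have [] := closed_quark_space m p 0 (R := R).
Qed.

Lemma bblock_quark_space m p (j : int) n (k : int) :
  quark_space m p j (fun x => (@bblock R m n (2 ^ j * x - k%:~R))%:C).
Proof.
apply: sub_L2closure; first exact/linear_span_L2/quark_gens_L2.
rewrite (_ : (fun x => _) = (fun x => \sum_(i < n) 1 *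
   (@quark R m 0 (2 ^ j * x - (k + i%:Z + (m./2)%:Z)%:~R))%:C)).
  apply: lin_closed_sum; [exact: linear_span0|exact: linear_span_lin|move=> i _].
  exact: span_quark.
apply/funext => x; rewrite rmorph_sum/=; apply: eq_bigr => i _; rewrite mul1r.
rewrite /quark expr0 mul1r; congr ((N m _)%:C).
by rewrite !rmorphD/=; ring.
Qed.

(** The block of translates at level j whose indices cover [2^j a, 2^j b) differs from
    the indicator only within distance (m+2)/2^j of the two end points, and by at
    most one there. *)
Lemma indicator_itv_quark m p a b :
  L2closure (quark_union m.+1 p) (fun x : R => (\1_(`]a, b]%classic) x)%:C).
Proof.
have [ba|ab] := leP b a.
  rewrite (_ : (fun x => _) = fun=> 0); first exact: quark_closure0.
  apply/funext => x; rewrite set_itv_ge ?indic0// bnd_simp -leNgt//.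
set f := fun x : R => _.
have mf : cmeasurable f by apply: cmeasurable_real; exact: measurable_indic.
have fb x : \1_(`]a, b]%classic) x = (a < x <= b)%R%:R :> R.
  by rewrite indicE mem_setE in_itv.
apply: L2closure_approx; first exact: quark_union_L2.
  apply/L2P; split=> //.
  rewrite (_ : f = cut `]a, b]%classic (fun=> 1)); last first.
    by apply/funext => x; rewrite /cut mulr1.
  apply: (@le_lt_trans _ _ (1 * mu `]a, b])%E).
    apply: sqnorm_cut_bounded; [exact: measurable_itv| |exact: lee01|].
      exact: cmeasurable_cst.
    by move=> x _; rewrite ComplexField.Normc.normc1 expr1n.
  by rewrite mul1e lebesgue_measure_itv/= lte_fin ab -EFinB ltry.
move=> e e0.
have [j je] : exists j : nat, 4 * m.+2%:R / e < 2 ^+ j :> R.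
  exists (Num.truncn (4 * m.+2%:R / e : R)).+1.
  apply: lt_trans (truncnS_gt _) _; rewrite -natrX ltr_nat.
  exact: ltn_expl.
pose c : R := 2 ^ j%:Z; have c0 : 0 < c by exact: expz2_gt0.
pose ka := Num.floor (c * a); pose kb := Num.floor (c * b).
have kab : (ka <= kb)%R by apply: le_floor; rewrite ler_pM2l// ltW.
pose n := `|kb - ka|%N.
have nE : n%:R = kb%:~R - ka%:~R :> R.
  by rewrite -rmorphB/= -[kb - ka]gez0_abs ?subr_ge0.
pose h x := @bblock R m.+1 n (c * x - ka%:~R).
have mh : measurable_fun setT h.
  apply: (measurableT_comp (measurable_bblock _ _)); exact: measurable_affine.
exists (fun x => (h x)%:C).
  apply: sub_L2closure (@quark_union_L2 m.+1 p) _ _.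
  by exists j%:Z => //; exact: bblock_quark_space.
(* after dilation: the order m+1 of the spline, plus one for the rounding *)
pose d : R := m.+2%:R / c.
have d0 : 0 < d by rewrite divr_gt0.
have cd : c * d = m.+2%:R by rewrite /d mulrC divfK// gt_eqF.
pose D : set R := `[a - d, a + d]%classic `|` `[b - d, b + d]%classic.
have mD : measurable D by apply: measurableU.
have mdiff : cmeasurable (fun x => f x - (h x)%:C).
  by apply: cmeasurableB => //; exact: cmeasurable_real.
have -> : (fun x => f x - (h x)%:C) = cut D (fun x => f x - (h x)%:C).
  apply/funext => x; rewrite /cut indicE.
  case: (boolP (x \in D)) => [_|]; first by rewrite mul1r.
  rewrite notin_setE /D /= !in_itv/= => nD; rewrite mul0r.
  suff -> : h x = \1_(`]a, b]%classic) x by rewrite subrr.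
  rewrite fb /h.
  have /andP[ka1 ka2] := floor_itv (c * a); have /andP[kb1 kb2] := floor_itv (c * b).
  rewrite -/ka intrD1 in ka1 ka2; rewrite -/kb intrD1 in kb1 kb2.
  have m2E : m.+2%:R = m%:R + 2 :> R by rewrite -addn2 natrD.
  have m1E : m.+1%:R = m%:R + 1 :> R by rewrite -natr1.
  have m0 := ler0n R m.
  have Hc (y z : R) : y < z -> c * y < c * z by rewrite ltr_pM2l.
  have [xa|xa] := ltP x (a - d).
    rewrite (_ : (a < x <= b) = false); last first.
      by apply/negbTE; rewrite negb_and -leNgt; apply/orP; left; lra.
    by apply: bblock_lt0; have := Hc _ _ xa; rewrite mulrBr cd; lra.
  have [xa'|xa'] := leP x (a + d); first by case: nD; left; rewrite xa xa'.
  have [xb|xb] := ltP x (b - d).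
    rewrite (_ : (a < x <= b) = true); last by apply/andP; split; lra.
    apply: bblock_eq1; rewrite nE; apply/andP.
    have := Hc _ _ xb; have := Hc _ _ xa'; rewrite mulrBr mulrDr cd.
    by split; lra.
  have [xb'|xb'] := leP x (b + d); first by case: nD; right; rewrite xb xb'.
  rewrite (_ : (a < x <= b) = false); last first.
    by apply/negbTE; rewrite negb_and -!ltNge; apply/orP; right; lra.
  apply: bblock_ge; rewrite nE.
  by have := Hc _ _ xb'; rewrite mulrDr cd; lra.
apply: (@le_lt_trans _ _ (1 * mu D)%E).
  apply: sqnorm_cut_bounded => // x _; rewrite -rmorphB normc_real lee_fin.
  have h0 : 0 <= h x by exact: bblock_ge0.
  have h1 : h x <= 1 by exact: bblock_le1.
  rewrite -(real_normK (num_real _)); apply: exprn_ile1 => //.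
  by rewrite fb ler_norml; case: (a < x <= b); apply/andP; split=> /=; lra.
rewrite mul1e.
apply: (@le_lt_trans _ _
    (mu `[(a - d)%R, (a + d)%R] + mu `[(b - d)%R, (b + d)%R])%E).
  exact: measureU2.
have muI (z : R) : mu `[z - d, z + d] = (2 * d)%:E.
  rewrite lebesgue_measure_itv/= lte_fin ifT; last lra.
  by rewrite -EFinB; congr EFin; ring.
rewrite !muI -EFinD lte_fin.
have -> : 2 * d + 2 * d = (4 * m.+2%:R) / c by rewrite /d; field; rewrite gt_eqF.
by move: je; rewrite !ltr_pdivrMr// (mulrC e).
Qed.

(** The Borel sets whose trace on a bounded window has its indicator in the closure
    form a Dynkin system: complements by linearity, disjoint unions by dominated
    convergence.  The window keeps the indicators in L_2. *)
Lemma indicator_quark m p (A : set R) K : measurable A ->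
  L2closure (quark_union m.+1 p) (fun x : R => (\1_(A `&` cells K) x)%:C).
Proof.
set W := L2closure _.
have W0 : W (fun=> 0) by exact: quark_closure0.
have Wl : lin_closed W by exact: quark_closure_lin.
move=> mA; pose P (B : set R) := W (fun x : R => (\1_(B `&` cells K) x)%:C).
have mcells : measurable (cells K) by exact: measurable_itv.
have mI (B : set R) : measurable B ->
    measurable_fun setT (\1_(B `&` cells K) : R -> R).
  by move=> mB; apply: measurable_indic; exact: measurableI.
rewrite -/(P A); apply: (@dynkin_induction _ (measurableTypeR R) (@ocitv R)) mA => //.
- exact: ocitvI.
- by rewrite /P setTI; exact: indicator_itv_quark.
- move=> _ [[a b] _ <-]; rewrite /P /=.
  have /ocitvP[->|[[c d] _ ->]] : ocitv (`]a, b] `&` cells K).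
    by apply: ocitvI; exact: is_ocitv.
  + by rewrite (_ : (fun x => _) = fun=> 0)//; apply/funext => x; rewrite indic0.
  + exact: indicator_itv_quark.
- move=> B mB PB; rewrite /P (_ : (fun x => _) = (fun x =>
     (-1) * (\1_(B `&` cells K) x)%:C + (\1_(cells K) x)%:C)).
    by apply: Wl => //; exact: indicator_itv_quark.
  apply/funext => x; rewrite mulN1r -rmorphN -rmorphD/=; congr (_%:C).
  rewrite !indicE !in_setI in_setC.
  by case: (_ \in _); case: (_ \in _) => /=; ring.
- move=> F mF tF PF.
  pose G n := \big[setU/set0]_(k < n) F k.
  have mG n : measurable (G n) by exact: bigsetU_measurable.
  have WG n : W (fun x => (\1_(G n `&` cells K) x)%:C).
    rewrite /G; elim: n => [|n IH].
      rewrite big_ord0 set0I (_ : (fun x => _) = fun=> 0)//.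
      by apply/funext => x; rewrite indic0.
    rewrite (_ : (fun x => _) = (fun x => 1 * (\1_(G n `&` cells K) x)%:C +
        (\1_(F n `&` cells K) x)%:C)); first by apply: Wl => //; exact: PF.
    apply/funext => x; rewrite mul1r -rmorphD/=; congr (_%:C).
    rewrite big_ord_recr/= -/(G n) !indicE !in_setI in_setU.
    have dis : ~~ ((x \in G n) && (x \in F n)).
      apply/negP => /andP[]; rewrite !inE /G -bigcup_mkord => -[i /= ilt Fi] Fn.
      have := tF i n I I; move=> /(_ (ex_intro _ x (conj Fi Fn))) ein.
      by move: ilt; rewrite ein ltnn.
    by move: dis; case: (_ \in _); case: (_ \in _); case: (_ \in _) => //= _; ring.
  apply: (@L2closure_dominated _ (fun n => \1_(G n `&` cells K)) _ (\1_(cells K))).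
  + exact: quark_union_L2.
  + by move=> n; exact: mI (mG n).
  + by apply: mI; exact: bigcupT_measurable.
  + exact: measurable_indic.
  + move=> x; apply: cvg_near_cst.
    have [[i _ Fi]|nF] := pselect ((\bigcup_k F k) x).
      exists i.+1 => // n /= ilt; rewrite !indicE !in_setI; congr ((nat_of_bool (_ && _))%:R).
      by rewrite !mem_set//; [exists i|rewrite /G -bigcup_mkord; exists i].
    exists 0%N => // n _ /=; rewrite !indicE !in_setI; congr ((nat_of_bool (_ && _))%:R).
    rewrite !memNset//; apply: contra_not nF; rewrite /G -bigcup_mkord.
    by move=> [i _ Fi]; exists i.
  + move=> n x; rewrite !indicE !in_setI.
    by case: (_ \in _); case: (_ \in _); rewrite ?normr0 ?normr1.
  + move=> x; rewrite !indicE !in_setI.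
    by case: (_ \in _); case: (_ \in _); rewrite ?normr0 ?normr1.
  + have := indicator_itv_quark m p (- K%:R) K%:R => -[/L2P[_ + _]].
    apply: le_lt_trans; rewrite le_eqVlt; apply/orP; left; apply/eqP.
    by apply: eq_integral => x _; rewrite normc_real.
  + exact: WG.
Qed.

Import HBNNSimple.

(** The simple approximations of [u], cut off to bounded windows, are finite
    combinations of indicators of bounded Borel sets and are dominated by [u]. *)
Lemma ge0_quark_closure m p (u : R -> R) : measurable_fun setT u ->
  (forall x, 0 <= u x) -> (\int[mu]_x (u x ^+ 2)%:E < +oo)%E ->
  L2closure (quark_union m.+1 p) (fun x => (u x)%:C).
Proof.
move=> mu_ u0 uy.
have W0 := @quark_closure0 m.+1 p.
have Wl := @quark_closure_lin m.+1 p (ltn0Sn m).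
have mE : measurable_fun [set: R] (EFin \o u) by apply/measurable_EFinP.
pose phi := nnsfun_approx measurableT mE.
have phile n x : phi n x <= u x.
  rewrite -lee_fin /phi nnsfun_approxE.
  by apply: le_approx => // y _; rewrite lee_fin.
have cphi x : phi n x @[n --> \oo] --> u x.
  rewrite -[u x]/(fine (EFin (u x))); under eq_fun do rewrite /phi nnsfun_approxE.
  by apply: cvg_approx => //; [move=> y _; rewrite lee_fin|rewrite /= ltry].
have mcells n : measurable (cells n) by exact: measurable_itv.
have le_phi n x : `|phi n x * \1_(cells n) x| <= u x.
  rewrite ger0_norm ?mulr_ge0//; apply: le_trans (phile n x).
  by rewrite ler_piMr// indicE; case: (_ \in _).
apply: (@L2closure_dominated _ (fun n x => phi n x * \1_(cells n) x) _ u) => //.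
- exact: quark_union_L2.
- by move=> n; apply: measurable_funM => //; exact: measurable_indic.
- move=> x; rewrite -[u x]mulr1; apply: cvgM; first exact: cphi.
  apply: cvg_near_cst; exists (Num.truncn `|x|).+1 => // n /= xn.
  have : `|x| < n%:R by apply: lt_le_trans (truncnS_gt _) _; rewrite ler_nat.
  rewrite ltr_norml => /andP[h1 h2].
  by rewrite indicE mem_set// /cells /= in_itv/= h1 ltW.
- by move=> x; rewrite ger0_norm.
- move=> n; pose r := fset_set (range (phi n)).
  rewrite (_ : (fun x => _) = (fun x => \sum_(y <- r) y%:C *
      (\1_(phi n @^-1` [set y] `&` cells n) x)%:C)).
    apply: lin_closed_sum => // y _; apply: indicator_quark.
    by rewrite -[X in measurable X]setTI; exact: measurable_funP.
  apply/funext => x; rewrite fimfunE fsbig_finite//= mulr_suml rmorph_sum/=.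
  apply: eq_bigr => y _; rewrite -rmorphM/= -mulrA; congr ((_ * _)%:C).
  by rewrite !indicE in_setI; case: (_ \in _); case: (_ \in _); rewrite ?mulr1 ?mulr0.
Qed.

Lemma real_quark_closure m p (u : R -> R) : measurable_fun setT u ->
  (\int[mu]_x (u x ^+ 2)%:E < +oo)%E ->
  L2closure (quark_union m.+1 p) (fun x => (u x)%:C).
Proof.
have half (w : R -> R) : measurable_fun setT w ->
    (\int[mu]_x (w x ^+ 2)%:E < +oo)%E ->
    L2closure (quark_union m.+1 p) (fun x => (Num.max (w x) 0)%:C).
  move=> mw wy; apply: ge0_quark_closure.
  - exact: measurable_maxr.
  - by move=> x; rewrite le_max lexx orbT.
  - apply: le_lt_trans wy; apply: ge0_le_integral => //.
    + by move=> x _; rewrite lee_fin sqr_ge0.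
    + by apply/measurable_EFinP; apply: measurable_funX; exact: measurable_maxr.
    + by apply/measurable_EFinP; exact: measurable_funX.
    + move=> x _; rewrite lee_fin; case: (leP (w x) 0) => // w0.
      by rewrite expr0n sqr_ge0.
move=> mu_ uy; rewrite (_ : (fun x => _) = (fun x =>
  (-1) * (Num.max (- u x) 0)%:C + (Num.max (u x) 0)%:C)).
  apply: quark_closure_lin => //; apply: half => //.
    exact: measurable_funN.
  by under eq_integral do rewrite sqrrN.
apply/funext => x; rewrite mulN1r -rmorphN -rmorphD/=; congr (_%:C).
by case: (leP (u x) 0); case: (leP (- u x) 0); lra.
Qed.

Theorem quark_space_dense m p : (0 < m)%N ->
  L2closure (\bigcup_j @quark_space R m p j) = L2.
Proof.
case: m => // m _; apply/seteqP; split; first exact: L2closure_sub.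
move=> f /L2P[[mr mi] fy].
have Hw (w : R -> R) : measurable_fun setT w ->
    (forall x, w x ^+ 2 <= normc (f x) ^+ 2) ->
    L2closure (quark_union m.+1 p) (fun x => (w x)%:C).
  move=> mw wf; apply: real_quark_closure => //.
  apply: le_lt_trans fy; apply: ge0_le_integral => //.
  - by move=> x _; rewrite lee_fin sqr_ge0.
  - by apply/measurable_EFinP; exact: measurable_funX.
  - by apply/measurable_EFinP; apply: measurable_sqr_normc.
  - by move=> x _; rewrite lee_fin.
rewrite (_ : f = fun x => 'i * (complex.Im (f x))%:C + (complex.Re (f x))%:C); last first.
  by apply/funext => x; case: (f x) => a b; rewrite /=; simpc.
apply: quark_closure_lin => //; apply: Hw => // x; rewrite sqr_normc.
  by rewrite lerDr sqr_ge0.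
by rewrite lerDl sqr_ge0.
Qed.

End Density.

(** * Stability of integer translates *)

Section ShiftStability.
Context {R : realType} (n : nat) (f : 'I_n -> R -> R) (B : R) (N : nat).
Local Notation mu := (@lebesgue_measure R).
Local Notation normc := ComplexField.Normc.normc.
Implicit Types (v : int -> 'cV[R[i]]_n) (A : {fset int}).

Hypothesis mf : forall l, measurable_fun setT (f l).
Hypothesis fB : forall l x, `|f l x| <= B.
Hypothesis fN : forall l x, ~ sym_itv N x -> f l x = 0.

Let F : 'I_n -> R -> R[i] := fun l x => (f l x)%:C.

Definition coef_energy v (k : int) : R := \sum_(l < n) normc (v k l ord0) ^+ 2.
Definition partial_energy v A : R := \sum_(k <- A) coef_energy v k.

Lemma coef_energy_ge0 v k : 0 <= coef_energy v k.
Proof. by apply: sumr_ge0 => l _; exact: sqr_ge0. Qed.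

Lemma partial_energy_ge0 v A : 0 <= partial_energy v A.
Proof. by apply: sumr_ge0 => k _; exact: coef_energy_ge0. Qed.

(** The integers k for which the translate by [k] may be nonzero at [x]. *)
Definition window (x : R) : seq int :=
  [seq Num.floor x - N%:Z + i%:Z | i <- iota 0 N.*2.+1].

Lemma mem_window x (k : int) : sym_itv N (x - k%:~R) -> k \in window x.
Proof.
rewrite /sym_itv /= in_itv/= => /andP[h1 h2].
have /andP[x1 x2] := floor_itv x; set j := Num.floor x in x1 x2 *.
have kj : (k <= j + N%:Z)%R.
  have : k%:~R < (j + 1 + N%:Z)%:~R :> R by rewrite rmorphD/=; lra.
  by rewrite ltr_int; lia.
have jk : (j - N%:Z <= k)%R.
  have : (j - N%:Z)%:~R < (k + 1)%:~R :> R by rewrite rmorphB rmorphD/=; lra.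
  by rewrite ltr_int; lia.
apply/mapP; exists (absz (k - (j - N%:Z))%R).
  by rewrite mem_iota; lia.
by rewrite -/j; lia.
Qed.

Let shift_eq0 l x k : k \notin window x -> F l (x - k%:~R) = 0.
Proof.
by move=> kx; rewrite /F fN// => /mem_window kx'; rewrite kx' in kx.
Qed.

Lemma sqr_normc_sum_le I (s : seq I) (z : I -> R[i]) :
  normc (\sum_(i <- s) z i) ^+ 2 <= (size s)%:R * \sum_(i <- s) normc (z i) ^+ 2.
Proof.
rewrite sqr_normc !raddf_sum/=.
under [in leRHS]eq_bigr do rewrite sqr_normc.
by rewrite big_split/= mulrDr lerD// sqr_sum_le.
Qed.

Lemma sqr_normc_sum_ord_le (z : 'I_n -> R[i]) :
  normc (\sum_(i < n) z i) ^+ 2 <= n%:R * \sum_(i < n) normc (z i) ^+ 2.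
Proof.
have := sqr_normc_sum_le (index_enum 'I_n) z.
by rewrite [index_enum _]unlock /= -enumT size_enum_ord.
Qed.

Lemma normc_conj (z : R[i]) : normc (Num.conj z) ^+ 2 = normc z ^+ 2.
Proof. by rewrite !sqr_normc; case: z => a b /=; rewrite sqrrN. Qed.

Lemma shift_sum_term v (k : int) l x :
  normc ((v k l ord0)^* * F l (x - k%:~R)) ^+ 2 =
  normc (v k l ord0) ^+ 2 * f l (x - k%:~R) ^+ 2.
Proof. by rewrite ComplexField.Normc.normcM exprMn normc_conj normc_real. Qed.

(** Only boundedly many translates meet a given point, so the Cauchy-Schwarz
    inequality can be applied pointwise. *)
Lemma shift_sum_pointwise v A x : normc (shift_sum F v A x) ^+ 2 <=
  (N.*2.+1 * n)%:R * \sum_(k <- A) \sum_(l < n)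
    normc (v k l ord0) ^+ 2 * f l (x - k%:~R) ^+ 2.
Proof.
pose s := [seq k <- A | k \in window x].
have -> : shift_sum F v A x =
    \sum_(k <- s) \sum_(l < n) (v k l ord0)^* * F l (x - k%:~R).
  rewrite /s big_filter big_mkcond/=; apply: eq_bigr => k _.
  by case: ifPn => // kx; rewrite big1// => l _; rewrite shift_eq0// mulr0.
apply: le_trans (sqr_normc_sum_le _ _) _.
have ss : (size s <= N.*2.+1)%N.
  rewrite -(size_iota 0 N.*2.+1) -(size_map (fun i => Num.floor x - N%:Z + i%:Z)).
  apply: uniq_leq_size; first by rewrite filter_uniq ?fset_uniq.
  by move=> k; rewrite mem_filter => /andP[].
apply: (@le_trans _ _ (N.*2.+1%:R * \sum_(k <- A) (n%:R * \sum_(l < n)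
    normc (v k l ord0) ^+ 2 * f l (x - k%:~R) ^+ 2))); last first.
  by rewrite -mulr_sumr mulrA natrM.
apply: ler_pM => //; last 2 first.
- by rewrite ler_nat.
- rewrite /s big_filter big_mkcond/=; apply: ler_sum => k _.
  have h0 : 0 <= n%:R * \sum_(l < n) normc (v k l ord0) ^+ 2 * f l (x - k%:~R) ^+ 2.
    by rewrite mulr_ge0// sumr_ge0// => l _; rewrite mulr_ge0// sqr_ge0.
  case: ifP => // _; apply: le_trans (sqr_normc_sum_ord_le _) _.
  by rewrite (eq_bigr _ (fun l _ => shift_sum_term v k l x)).
- by apply: sumr_ge0 => k _; exact: sqr_ge0.
Qed.

Let cF l : cmeasurable (F l).
Proof. exact: cmeasurable_real. Qed.

Lemma cmeasurable_shift_sum v A : cmeasurable (shift_sum F v A).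
Proof.
apply: cmeasurable_sum => k _; apply: cmeasurable_sum => l _.
apply: cmeasurableZ; apply: cmeasurable_comp => //.
by apply: measurable_funB => //; exact: measurable_cst.
Qed.

Definition upper_const : R := (N.*2.+1 * n)%:R * (B ^+ 2 * (2 * N%:R)) + 1.

Lemma upper_const_gt0 : 0 < upper_const.
Proof.
by rewrite /upper_const ltr_wpDl// mulr_ge0// mulr_ge0 ?sqr_ge0// mulr_ge0.
Qed.

(** Integrate the pointwise estimate; the translates of one generator all have the
    same norm. *)
Lemma shift_sum_upper v A :
  (sqnorm (shift_sum F v A) <= (upper_const * partial_energy v A)%:E)%E.
Proof.
have m2 k l : measurable_fun setT (fun x : R =>
    ((normc (v k l ord0) ^+ 2)%:E * (f l (x - k%:~R) ^+ 2)%:E)%E).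
  apply: emeasurable_funM => //; apply/measurable_EFinP; apply: measurable_funX.
  apply: (measurableT_comp (mf l)).
  by apply: measurable_funB => //; exact: measurable_cst.
have p2 k l (x : R) :
    (0 <= (normc (v k l ord0) ^+ 2)%:E * (f l (x - k%:~R)%R ^+ 2)%:E)%E.
  by rewrite mule_ge0// lee_fin sqr_ge0.
apply: (@le_trans _ _ (\int[mu]_x ((N.*2.+1 * n)%:R%:E *
    \sum_(k <- A) \sum_(l < n)
      ((normc (v k l ord0) ^+ 2)%:E * (f l (x - k%:~R)%R ^+ 2)%:E)))%E).
  apply: ge0_le_integral => //.
  - by move=> x _; rewrite lee_fin sqr_ge0.
  - by apply/measurable_EFinP; apply: measurable_sqr_normc; exact: cmeasurable_shift_sum.
  - apply: emeasurable_funM => //; apply: emeasurable_sum => k.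
    by apply: emeasurable_sum => l; exact: m2.
  - move=> x _; under eq_bigr do under eq_bigr do rewrite -EFinM.
    under eq_bigr do rewrite sumEFin.
    by rewrite sumEFin -EFinM lee_fin shift_sum_pointwise.
rewrite ge0_integralZl//; first last.
- by move=> x _; apply: sume_ge0 => k _; apply: sume_ge0 => l _; exact: p2.
- by apply: emeasurable_sum => k; apply: emeasurable_sum => l; exact: m2.
rewrite ge0_integral_sum//; first last.
- by move=> k x _; apply: sume_ge0 => l _; exact: p2.
- by move=> k; apply: emeasurable_sum => l; exact: m2.
apply: (@le_trans _ _ ((N.*2.+1 * n)%:R%:E *
    (partial_energy v A * (B ^+ 2 * (2 * N%:R)))%:E)%E); last first.
  rewrite -EFinM lee_fin /upper_const [leRHS]mulrDl mul1r.
  by rewrite [leLHS]mulrCA [leLHS]mulrC lerDl partial_energy_ge0.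
rewrite lee_wpmul2l// /partial_energy mulr_suml -sumEFin; apply: lee_sum => k _.
rewrite ge0_integral_sum//; last by move=> l; exact: m2.
rewrite /coef_energy mulr_suml -sumEFin; apply: lee_sum => l _.
have mfl : measurable_fun setT (fun x : R => (f l (x - k%:~R) ^+ 2)%:E).
  apply/measurable_EFinP; apply: measurable_funX; apply: (measurableT_comp (mf l)).
  by apply: measurable_funB => //; exact: measurable_cst.
have v20 : (0 <= (normc (v k l ord0) ^+ 2)%:E)%E by rewrite lee_fin sqr_ge0.
have f20 (x : R) : (0 <= (f l (x - k%:~R)%R ^+ 2)%:E)%E by rewrite lee_fin sqr_ge0.
rewrite ge0_integralZl//.
rewrite (EFinM (normc (v k l ord0) ^+ 2)) lee_wpmul2l//.
have [le _] := L2_bounded (mf l) (fB l) (@fN l).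
apply: le_trans le; rewrite -[leRHS]mul1e -[X in (X%:E * _)%E]invr1.
rewrite -(@sqnorm_affine R 1 (- k%:~R) (F l) ltr01 (cF l)).
rewrite le_eqVlt; apply/orP; left; apply/eqP; apply: eq_integral => x _.
by rewrite normc_real mul1r.
Qed.

(** The value at each point of the bi-infinite series, which has only finitely many
    nonzero terms there. *)
Definition shift_lim v : R -> R[i] :=
  fun x => shift_sum F v (seq_fset tt (window x)) x.

Lemma shift_limE v A x : {subset window x <= A} -> shift_sum F v A x = shift_lim v x.
Proof.
move=> xA; symmetry; apply: big_fset_incl.
  by apply/fsubsetP => k; rewrite seq_fsetE; exact: xA.
move=> k _; rewrite seq_fsetE => kx.
by rewrite big1// => l _; rewrite shift_eq0// mulr0.
Qed.

(** A sequence of finite sets of integers that eventually contains any given one. *)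
Definition exhaust (j : nat) : {fset int} := seq_fset tt (pmap choice.unpickle (iota 0 j)).

Lemma exhaustP (s : seq int) : exists j0, forall j, (j0 <= j)%N ->
  {subset s <= exhaust j}.
Proof.
exists (\max_(k <- s) choice.pickle k).+1 => j jj k ks.
rewrite seq_fsetE mem_pmap; apply/mapP.
exists (choice.pickle k); last by rewrite choice.pickleK.
rewrite mem_iota/= add0n; apply: leq_trans jj; rewrite ltnS.
exact: leq_bigmax_seq.
Qed.

Let l2_energy_ge0 v : (0 <= l2_energy v)%E.
Proof. by apply: esum_ge0 => k _; rewrite lee_fin coef_energy_ge0. Qed.

Lemma partial_energy_le v A : ((partial_energy v A)%:E <= l2_energy v)%E.
Proof.
apply: esum_ge; exists [set` A]; first by split=> //; exact: finite_fset.
rewrite -fsbig_seq ?fset_uniq// /partial_energy -sumEFin.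
by [].
Qed.

Lemma partial_energyU v A A' :
  partial_energy v (A `|` A')%fset =
  partial_energy v A + partial_energy v (A' `\` A)%fset.
Proof.
rewrite /partial_energy (big_fsetID _ [pred k | k \in A]) /=; congr (_ + _).
  apply: eq_fbigl => k; rewrite !inE /=.
  by case: (k \in A); rewrite ?andbT ?andbF.
apply: eq_fbigl => k; rewrite !inE /=.
by case: (k \in A); rewrite ?andbT ?andbF.
Qed.

Lemma shift_sumU v A A' x :
  shift_sum F v (A `|` A')%fset x - shift_sum F v A x = shift_sum F v (A' `\` A)%fset x.
Proof.
apply/eqP; rewrite subr_eq addrC; apply/eqP.
rewrite /shift_sum (big_fsetID _ [pred k | k \in A]) /=; congr (_ + _).
  apply: eq_fbigl => k; rewrite !inE /=.
  by case: (k \in A); rewrite ?andbT ?andbF.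
apply: eq_fbigl => k; rewrite !inE /=.
by case: (k \in A); rewrite ?andbT ?andbF.
Qed.

Lemma cmeasurable_shift_lim v : cmeasurable (shift_lim v).
Proof.
apply: (cmeasurable_eventually (F := fun j => shift_sum F v (exhaust j))).
  by move=> j; exact: cmeasurable_shift_sum.
move=> x; have [j0 Hj] := exhaustP (window x); exists j0 => j jj.
by apply: shift_limE; exact: Hj.
Qed.

Lemma shift_lim_upper v : (sqnorm (shift_lim v) <= upper_const%:E * l2_energy v)%E.
Proof.
apply: (sqnorm_fatou (F := fun j => shift_sum F v (exhaust j))).
- by move=> j; exact: cmeasurable_shift_sum.
- move=> x; have [j0 Hj] := exhaustP (window x); exists j0 => j jj.
  by apply: shift_limE; exact: Hj.
- move=> j; apply: le_trans (shift_sum_upper _ _) _.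
  by rewrite EFinM lee_pmul2l ?lte_fin ?upper_const_gt0// partial_energy_le.
Qed.

(** The difference is the pointwise limit of the partial sums over the parts of the
    exhausting sets outside [A]; each of them obeys the upper estimate. *)
Lemma shift_lim_tail v A : (l2_energy v < +oo)%E ->
  (sqnorm (fun x => shift_lim v x - shift_sum F v A x)%R <=
   upper_const%:E * (l2_energy v - (partial_energy v A)%:E))%E.
Proof.
move=> vy.
have vfin : l2_energy v \is a fin_num.
  by rewrite ge0_fin_numE.
apply: (sqnorm_fatou (F := fun j x =>
    shift_sum F v (A `|` exhaust j)%fset x - shift_sum F v A x)).
- by move=> j; apply: cmeasurableB; exact: cmeasurable_shift_sum.
- move=> x; have [j0 Hj] := exhaustP (window x); exists j0 => j jj.
  rewrite (@shift_limE v (A `|` exhaust j)%fset)// => k kx.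
  by rewrite inE (Hj j jj k kx) orbT.
- move=> j; under [X in sqnorm X]eq_fun do rewrite shift_sumU.
  apply: le_trans (shift_sum_upper _ _) _.
  rewrite EFinM lee_pmul2l ?lte_fin ?upper_const_gt0//.
  rewrite leeBrDr//; apply: le_trans (partial_energy_le v (A `|` exhaust j)%fset).
  by rewrite partial_energyU -EFinD addrC.
Qed.

Lemma shift_series_lim v : (l2_energy v < +oo)%E -> shift_series F v (shift_lim v).
Proof.
move=> vy.
have vfin : l2_energy v \is a fin_num by rewrite ge0_fin_numE.
split.
  apply/L2P; split; first exact: cmeasurable_shift_lim.
  apply: le_lt_trans (shift_lim_upper v) _.
  by rewrite lte_mul_pinfty// lee_fin ltW// upper_const_gt0.
have small e : 0 < e -> exists A0, forall A, (A0 `<=` A)%fset ->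
    (L2norm (fun x => shift_lim v x - shift_sum F v A x)%R < e%:E)%E.
  move=> e0; pose d := e ^+ 2 / (2 * upper_const).
  have d0 : 0 < d by rewrite divr_gt0 ?exprn_gt0 ?mulr_gt0 ?upper_const_gt0.
  have [_ [X [finX _] <-]] := ub_ereal_sup_adherent d0 vfin.
  rewrite fsbig_finite//= sumEFin => dX0.
  have dX : (l2_energy v - d%:E < (partial_energy v (fset_set X))%:E)%E := dX0.
  exists (fset_set X) => A XA; rewrite L2norm_lt//.
  apply: le_lt_trans (shift_lim_tail A vy) _.
  have le1 : partial_energy v (fset_set X) <= partial_energy v A.
    by rewrite -[A in leRHS](fsetUidPr _ _ XA) partial_energyU lerDl
      partial_energy_ge0.
  move: dX; rewrite -(fineK vfin) -!EFinB -EFinM !lte_fin => dX.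
  apply: (@le_lt_trans _ _ (upper_const * d)).
    by rewrite ler_pM2l ?upper_const_gt0//; lra.
  have -> : upper_const * d = e ^+ 2 / 2.
    by rewrite /d; field; rewrite gt_eqF// upper_const_gt0.
  by have := exprn_gt0 2 e0; lra.
have pf : ProperFilter (@totally int) := totally_filter.
apply/fine_cvgP; split.
  have [A0 HA] := small 1 ltr01; exists A0; [by []|move=> A AA; have h := HA A AA].
  have L0 : (0 <= L2norm (fun x => shift_lim v x - shift_sum F v A x)%R)%E.
    exact: Lnorm_ge0.
  by rewrite /mkset ge0_fin_numE// (lt_trans h) ?ltry.
apply/cvgrPdist_lt => e e0; have [A0 HA] := small e e0.
exists A0; [by []|move=> A AA; have h := HA A AA].
have L0 : (0 <= L2norm (fun x => shift_lim v x - shift_sum F v A x)%R)%E.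
  exact: Lnorm_ge0.
rewrite /mkset sub0r normrN ger0_norm ?fine_ge0//.
by rewrite -lte_fin fineK// ge0_fin_numE// (lt_trans h) ?ltry.
Qed.

(** The coefficients of the translates by [k] are controlled by the values of the
    sum on the single cell starting at k + s, whatever the other coefficients. *)
Definition shift_cell_lower (C : R) (s : int) : Prop :=
  forall A (a : int -> 'I_n -> R) (k : int), k \in A ->
  ((\sum_(l < n) a k l ^+ 2)%:E <=
   C%:E * \int[mu]_(y in `[0%R, 1%R[)
     ((\sum_(k' <- A) \sum_(l < n) a k' l * f l ((k + s)%:~R + y - k'%:~R)%R)%R ^+ 2)%:E)%E.

Let shift_cell (s k : int) : set R := [set x | `[0, 1[%classic (1 * x + - (k + s)%:~R)].

Let measurable_cell s k : measurable (shift_cell s k).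
Proof.
rewrite -[shift_cell s k]setTI; apply: measurable_affine => //.
Qed.

(** The window of x is the same for all x of a cell, so the series is one finite sum
    there.  The generators being real, the real and imaginary parts of the
    coefficients separate. *)
Lemma shift_lim_cell C s v k : 0 < C -> shift_cell_lower C s ->
  ((coef_energy v k)%:E <= C%:E * sqnorm (cut (shift_cell s k) (shift_lim v)))%E.
Proof.
move=> C0 HC.
pose x0 : R := (k + s)%:~R.
pose A : {fset int} := (k |` seq_fset tt (window x0))%fset.
have kA : k \in A by rewrite !inE eqxx.
have mlim := cmeasurable_shift_lim v.
pose g := fun y => shift_lim v (y + x0).
have mg : cmeasurable g.
  rewrite /g; apply: (cmeasurable_comp (phi := fun y => y + x0)) => //.
  by apply: measurable_funD => //; exact: measurable_cst.
have -> : sqnorm (cut (shift_cell s k) (shift_lim v)) = sqnorm (cut `[0, 1[%classic g).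
  rewrite -[RHS]mul1e -[X in (X%:E * _)%E]invr1.
  rewrite -(sqnorm_affine (- x0) ltr01); last exact: cmeasurable_cut.
  congr sqnorm; apply/funext => x; rewrite /cut /g mul1r subrK; congr (_%:C * _).
  rewrite !indicE; congr ((nat_of_bool _)%:R).
  by apply/idP/idP; rewrite !inE /shift_cell /= mul1r.
have gE y : 0 <= y < 1 -> g y = shift_sum F v A (x0 + y).
  move=> y01; rewrite /g addrC; apply/esym/shift_limE.
  have -> : window (x0 + y) = window x0.
    rewrite /window; have -> : Num.floor (x0 + y) = k + s.
      apply: floor_def; rewrite /x0 [in X in _ && X]rmorphD/=.
      by move/andP: y01 => [? ?]; apply/andP; split; lra.
    by rewrite /x0 intrKfloor.
  by move=> j jw; rewrite !inE seq_fsetE jw orbT.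
rewrite sqnorm_cut//.
have -> : (\int[mu]_(y in `[0%R, 1%R[) (normc (g y) ^+ 2)%:E =
  \int[mu]_(y in `[0%R, 1%R[)
     ((\sum_(k' <- A) \sum_(l < n) complex.Re (v k' l ord0) *
         f l ((k + s)%:~R + y - k'%:~R)%R)%R ^+ 2)%:E +
  \int[mu]_(y in `[0%R, 1%R[)
     ((\sum_(k' <- A) \sum_(l < n) - complex.Im (v k' l ord0) *
         f l ((k + s)%:~R + y - k'%:~R)%R)%R ^+ 2)%:E)%E.
  have ms (a : int -> 'I_n -> R) : measurable_fun (`[0, 1[%classic : set R) (fun y : R =>
    ((\sum_(k' <- A) \sum_(l < n) a k' l * f l ((k + s)%:~R + y - k'%:~R)) ^+ 2)%:E).
    apply/measurable_funTS/measurable_EFinP; apply: measurable_funX.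
    apply: measurable_sum => k'; apply: measurable_sum => l.
    apply: measurable_funM => //; apply: (measurableT_comp (mf l)).
    apply: measurable_funB => //; apply: measurable_funD => //; exact: measurable_cst.
  rewrite -ge0_integralD//; first last.
  - exact: (ms (fun k' l => - complex.Im (v k' l ord0))).
  - by move=> y _; rewrite lee_fin sqr_ge0.
  - exact: (ms (fun k' l => complex.Re (v k' l ord0))).
  - by move=> y _; rewrite lee_fin sqr_ge0.
  apply: eq_integral => y; rewrite inE/= in_itv/= => y01.
  rewrite gE// sqr_normc EFinD; congr (_%:E + _%:E)%E; congr (_ ^+ 2).
    rewrite /shift_sum raddf_sum; apply: eq_bigr => k' _.
    rewrite raddf_sum; apply: eq_bigr => l _.
    by rewrite /F; case: (v k' l ord0) => a b /=; rewrite mulr0 subr0.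
  rewrite /shift_sum raddf_sum; apply: eq_bigr => k' _.
  rewrite raddf_sum; apply: eq_bigr => l _.
  by rewrite /F; case: (v k' l ord0) => a b /=; rewrite mulr0 add0r.
rewrite ge0_muleDr; [|by apply: integral_ge0 => y _; rewrite lee_fin sqr_ge0|
  by apply: integral_ge0 => y _; rewrite lee_fin sqr_ge0].
have -> : (coef_energy v k)%:E = ((\sum_(l < n) complex.Re (v k l ord0) ^+ 2)%:E +
   (\sum_(l < n) (- complex.Im (v k l ord0)) ^+ 2)%:E)%E.
  rewrite -EFinD -big_split/=; congr EFin; apply: eq_bigr => l _.
  by rewrite sqr_normc sqrrN.
apply: leeD.
  exact: (HC A (fun k' l => complex.Re (v k' l ord0)) k kA).
exact: (HC A (fun k' l => - complex.Im (v k' l ord0)) k kA).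
Qed.

(** The cells attached to distinct integers are disjoint, so the local estimates
    add up. *)
Lemma shift_lim_lower C s v : 0 < C -> shift_cell_lower C s ->
  (l2_energy v <= C%:E * sqnorm (shift_lim v))%E.
Proof.
move=> C0 HC; apply: ge_ereal_sup => _ [X [finX _] <-].
rewrite fsbig_finite//= sumEFin.
have mlim := cmeasurable_shift_lim v.
apply: (@le_trans _ _ (\sum_(k <- fset_set X)
    (C%:E * sqnorm (cut (shift_cell s k) (shift_lim v)))%E)%R).
  by rewrite -sumEFin; apply: lee_sum => k _; exact: shift_lim_cell.
rewrite -ge0_sume_distrr; last by move=> k _; exact: sqnorm_ge0.
rewrite lee_pmul2l// /sqnorm -ge0_integral_sum//; first last.
- by move=> k x _; rewrite lee_fin sqr_ge0.
- move=> k; apply/measurable_EFinP; apply: measurable_sqr_normc.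
  exact: cmeasurable_cut.
apply: ge0_le_integral => //.
- by move=> x _; apply: sume_ge0 => k _; rewrite lee_fin sqr_ge0.
- apply: emeasurable_sum => k; apply/measurable_EFinP; apply: measurable_sqr_normc.
  exact: cmeasurable_cut.
- by apply/measurable_EFinP; exact: measurable_sqr_normc.
move=> x _; rewrite sumEFin lee_fin.
under eq_bigr do rewrite sqr_normc_cut.
rewrite -mulr_suml ler_piMl ?sqr_ge0//.
pose k0 := Num.floor x - s.
have -> : \sum_(k <- fset_set X) \1_(shift_cell s k) x =
    \sum_(k <- fset_set X) (k == k0)%:R :> R.
  apply: eq_bigr => k _; rewrite indicE; congr ((nat_of_bool _)%:R).
  apply/idP/idP; rewrite !inE /shift_cell /= in_itv/= mul1r subr_ge0 ltrBlDl.
    move=> h; have : Num.floor x = k + s by apply: floor_def; rewrite intrD1.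
    by rewrite /k0 => ->; rewrite addrK.
  move/eqP => ->; rewrite /k0 subrK; have := floor_itv x.
  by rewrite intrD1.
have -> : \sum_(k <- fset_set X) (k == k0)%:R = (count (pred1 k0) (fset_set X))%:R :> R.
  elim: (enum_fset _) => [|k r IH]; first by rewrite big_nil.
  by rewrite big_cons IH /= natrD.
rewrite count_uniq_mem ?fset_uniq//.
by case: (k0 \in _); rewrite ?ler01.
Qed.

Theorem shifts_L2_stable C s : 0 < C -> shift_cell_lower C s -> L2_stable F.
Proof.
move=> C0 HC; split.
  by move=> l; exact: (L2_bounded (mf l) (fB l) (@fN l)).2.
(* the minimum only serves to order the two constants *)
exists (Num.min C^-1 upper_const), upper_const; split.
  by rewrite lt_min invr_gt0 C0 upper_const_gt0 ge_min lexx orbT.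
move=> v vy; exists (shift_lim v).
split; first exact: shift_series_lim.
- rewrite L2norm_sqr; apply: (@le_trans _ _ ((C^-1)%:E * l2_energy v)%E).
    by rewrite lee_wpmul2r// lee_fin ge_min lexx.
  by rewrite lee_pdivrMl//; exact: (shift_lim_lower v C0 HC).
- by rewrite L2norm_sqr; exact: shift_lim_upper.
Qed.

End ShiftStability.

(** * Stability of the quarks, and the theorem *)

Section QuarkStability.
Context {R : realType}.
Local Notation mu := (@lebesgue_measure R).
Local Notation N := (@bspline R).

(** For m = 1 the generators live on one cell, where they are the monomials. *)
Lemma quark_cell_lower_m1 p : exists2 C : R, 0 < C &
  shift_cell_lower (fun l : 'I_p.+1 => @quark R 1 l) C 0.
Proof.
have [||C C0 HC] := @local_stability R p.+1 (fun i => 'X^i).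
- by move=> i; rewrite size_polyXn.
- exact: monomials_free.
exists C => // A a k kA; apply: (le_trans (HC (a k))).
rewrite lee_pmul2l// le_eqVlt; apply/orP; left; apply/eqP.
apply: eq_integral => y; rewrite inE/= in_itv/= => /andP[y0 y1].
congr ((_ ^+ 2)%:E); rewrite (bigD1_seq k kA (fset_uniq A))/= [X in _ = _ + X]big1 ?addr0.
  apply: eq_bigr => l _; rewrite hornerXn /quark /= !addr0 divr1.
  have -> : k%:~R + y - k%:~R = y :> R by rewrite addrC addrA addNr add0r.
  by rewrite bspline1 indicE mem_set ?mulr1//= in_itv/= y0 y1.
move=> k' k'k; apply: big1 => l _; rewrite /quark /= !addr0 bspline1 indicE memNset ?mulr0//=.
rewrite in_itv/= => /andP[h1 h2]; move/eqP: k'k; apply.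
have : k' < k + 1 by rewrite -(ltr_int R) rmorphD/=; lra.
have : k < k' + 1 by rewrite -(ltr_int R) rmorphD/=; lra.
by lia.
Qed.

Lemma sum_delta_seq (s : seq int) (j : int) (G : int -> R) : uniq s ->
  \sum_(k <- s) (k == j)%:R * G k = (j \in s)%:R * G j.
Proof.
move=> us; have [js|js] := boolP (j \in s).
  rewrite (bigD1_seq j)//= eqxx mul1r big1 ?addr0 ?mul1r// => k kj.
  by rewrite (negbTE kj) mul0r.
rewrite mul0r big1_seq// => k /= ks; case: eqP => [kj|]; last by rewrite mul0r.
by rewrite -kj ks in js.
Qed.

(** On one cell a spline is a combination of the polynomial pieces, the piece of
    index [i] having as coefficient that of the translate by [k - i]. *)
Lemma bspline_cell_sum m (s : seq int) (b : int -> R) (k : int) y : uniq s ->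
  0 <= y < 1 -> \sum_(k' <- s) b k' * N m.+1 ((k - k')%:~R + y) =
  \sum_(i < m.+1) ((k - i%:Z \in s)%:R * b (k - i%:Z)) * (bpiece m i).[y].
Proof.
move=> us y01.
(* when no i has k' = k - i, the spline vanishes at the argument *)
transitivity (\sum_(i < m.+1) \sum_(k' <- s) (k' == k - i%:Z)%:R *
    (b k' * N m.+1 ((k - k')%:~R + y))).
  rewrite exchange_big/=; apply: eq_bigr => k' _.
  rewrite -mulr_suml.
  have [k'k|kk'] := leP k' k; last first.
    rewrite bspline_lt0 ?mulr0//.
    have : (k - k' + 1)%:~R <= 0 :> R by rewrite (ler_int _ _ 0); lia.
    by rewrite rmorphD/=; case/andP: y01; lra.
  pose i := absz (k - k'); have iE : k - k' = i%:Z by rewrite /i; lia.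
  have [im|mi] := ltnP i m.+1.
    rewrite (bigD1 (Ordinal im))//= big1 ?addr0.
      by rewrite (_ : k' == _ = true) ?mul1r//; apply/eqP; lia.
    move=> j; rewrite -val_eqE/= => ji; rewrite (_ : k' == _ = false)//.
    by apply/negbTE/eqP; move/eqP: ji; lia.
  rewrite iE bspline_ge ?mulr0//.
  have : m.+1%:R <= i%:R :> R by rewrite ler_nat.
  by case/andP: y01; rewrite -[i%:~R]/(i%:R); lra.
apply: eq_bigr => i _; rewrite sum_delta_seq// -mulrA; congr (_ * (_ * _)).
have -> : (k - (k - i%:Z))%:~R = i%:R :> R by rewrite opprB addrC subrK.
exact: bspline_piece.
Qed.

(** For p = 0 the cell is chosen so that the translate by [k] appears on it through
    the first piece of the B-spline, which makes its coefficient the one of index 0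
    in the local stability estimate. *)
Lemma quark_cell_lower_p0 m : exists2 C : R, 0 < C &
  shift_cell_lower (fun l : 'I_1 => @quark R m.+1 l) C (- (m.+1./2)%:Z).
Proof.
have [||C C0 HC] := @local_stability R m.+1 (fun i => bpiece m i).
- by move=> i; exact: size_bpiece.
- exact: bpiece_free.
exists C => // A a k kA.
pose c (i : 'I_m.+1) := (k - i%:Z \in A)%:R * a (k - i%:Z) ord0.
apply: (@le_trans _ _ (\sum_(i < m.+1) c i ^+ 2)%:E).
  rewrite big_ord1 lee_fin big_ord_recl /c /= subr0 kA mul1r lerDl.
  by apply: sumr_ge0 => i _; exact: sqr_ge0.
apply: (le_trans (HC c)).
rewrite lee_pmul2l// le_eqVlt; apply/orP; left; apply/eqP.
apply: eq_integral => y; rewrite inE/= in_itv/= => y01.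
congr ((_ ^+ 2)%:E).
rewrite /c -(bspline_cell_sum m (fun k => a k ord0) k (fset_uniq A) y01).
apply: eq_bigr => k' _; rewrite big_ord1 /quark /= expr0 mul1r.
by congr (_ * N _ _); rewrite !rmorphD !rmorphN/=; ring.
Qed.

Lemma quarks_L2_stable m p : (0 < m)%N -> m = 1%N \/ p = 0%N ->
  L2_stable (fun (l : 'I_p.+1) x => (@quark R m l x)%:C).
Proof.
move=> m0 mp.
have B1 (l : 'I_p.+1) x : `|@quark R m l x| <= 1.
  apply: le_trans (normr_quark_le _ _ _) _.
  by case: mp l => -> l; [rewrite expr1n|rewrite ord1 expr0].
have [C [s [C0 HC]]] : exists C s, 0 < C /\
    shift_cell_lower (fun l : 'I_p.+1 => @quark R m l) C s.
  case: mp => [->|p0].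
    by have [C C0 HC] := quark_cell_lower_m1 p; exists C, 0.
  subst p; case: m m0 {B1} => // m _.
  by have [C C0 HC] := quark_cell_lower_p0 m; exists C, (- (m.+1./2)%:Z).
apply: (shifts_L2_stable (N := m) (B := 1) _ B1 _ C0 HC).
  by move=> l; exact: measurable_quark.
by move=> l x; exact: quark_support.
Qed.

Lemma quarks_multiscaling m p : (0 < m)%N -> m = 1%N \/ p = 0%N ->
  multiscaling_function (@quark_space R m p)
    (fun (l : 'I_p.+1) x => (@quark R m l x)%:C).
Proof.
move=> m0 mp; split; first exact: quarks_L2_stable.
rewrite quark_spaceE; congr (L2closure (linear_span _)).
have E q (k : int) : (fun x : R => (2 `^ (0%:~R / 2) * @quark R m q (2 ^ 0 * x - k%:~R))%:C)
    = (fun x => (@quark R m q (x - k%:~R))%:C).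
  by apply/funext => x; rewrite mul0r powRr0 mul1r expr0z mul1r.
apply/seteqP; split=> g /=.
  move=> [q [k [qp ->]]]; exists (inord q), k; rewrite E.
  by apply/funext => x; rewrite inordK.
move=> [l [k ->]]; exists l, k; rewrite E; split=> //.
by rewrite -ltnS.
Qed.

Lemma quark_mra m p : (0 < m)%N -> mra_properties (@quark_space R m p).
Proof.
move=> m0; split.
- by move=> j; exact: quark_space_nested.
- exact: quark_space_dense.
- apply/seteqP; split=> f.
    move=> Vf; have Vj j : quark_space m p j f by exact: Vf.
    have Lf : L2 f by have [] := Vj 0.
    split=> //; apply/sqnorm_eq0; first by have /L2P[] := Lf.
    exact: quark_space_meet m0 Vj.
  move=> [Lf f0] j _; have /L2P[mf _] := Lf.
  apply/L2closureP; split=> // e e0; exists (fun=> 0); first exact: linear_span0.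
  under [X in sqnorm X]eq_fun do rewrite subr0.
  by rewrite ((sqnorm_eq0 mf).2 f0) lte_fin.
- move=> j k f Lf; split; first exact: quark_space_translate.
  move=> /(@quark_space_translate R m p j (- k)); congr (quark_space m p j _).
  by apply/funext => x /=; congr f; rewrite rmorphN/=; ring.
- move=> j f Lf; split.
    by move=> /(@quark_space_dilate R m p j 1); rewrite expr1z.
  move=> /(@quark_space_dilate R m p (j + 1) (-1)); rewrite addrK.
  congr (quark_space m p j _); apply/funext => x /=; congr f.
  by rewrite exprN1 mulrA mulfV// mul1r.
Qed.

End QuarkStability.

Theorem theorem3p12 (R : realType) (m p : nat) (hm : (0 < m)%N) :
  mra_properties (@quark_space R m p) /\
  (m = 1%N \/ p = 0%N ->
   multiresolution_analysis (@quark_space R m p) /\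
   exists G : 'I_p.+1 -> R -> R[i]%C,
     multiscaling_function (@quark_space R m p) G).
Proof.
split; first exact: quark_mra.
move=> mp; have ms := quarks_multiscaling hm mp (R := R).
split; last by eexists; exact: ms.
split; [exact: closed_quark_space|exact: quark_mra|].
by exists p.+1; split=> //; eexists; exact: ms.
Qed.
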